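(* Let $N\geq 1$ be an integer, let $V$ be the vertex set of the infinite $N$-ary tree and let $\Delta$ be its graph Laplacian on $l^2(V)$ (conductance $1$ on every edge). Let $\mu_c$ be the measure on $[-1,1]$ given by $d\mu_c=\frac{2}{\pi}\sqrt{1-x^2}\,dx$, and let $\mu_{c+p}$ be the measure on $[-1,1]$ given by $$d\mu_{c+p}=\frac{\frac{2}{\pi}\sqrt{1-x^2}}{1-2N^{-1/2}x+N^{-1}}\,dx.$$ Then: (i) If $N=1$, then $\Delta$ is unitarily equivalent to the operator of multiplication by $2-2x$ on $L^2(\mu_{c+p})$. (ii) If $N\geq 2$, then $\Delta$ is unitarily equivalent to the multiplication operator $$M_{c+p}\oplus\bigoplus_{n=1}^\infty M_c\quad\text{on}\quad L^2(\mu_{c+p})\oplus\bigoplus_{n=1}^\infty L^2(\mu_c),$$ where $M_{c+p}$ is multiplication by $N+1-2\sqrt{N}x$ on $L^2(\mu_{c+p})$ and $M_c$ is multiplication by $N+1-2\sqrt{N}x$ on $L^2(\mu_c)$.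
   Context: The infinite $N$-ary tree: $V$ is the set of all finite words over the alphabet $\{1,\dots,N\}$, including the empty word $\emptyset$; its edges are exactly the pairs $\{\omega,\omega i\}$ with $\omega\in V$, $i\in\{1,\dots,N\}$, where $\omega i$ is the word obtained by appending the letter $i$ to $\omega$. Write $x\sim y$ if $x,y$ are adjacent. The graph Laplacian is $(\Delta v)(x)=\sum_{y\sim x}(v(x)-v(y))$, defined on finitely supported functions and extended by closure; it is a bounded selfadjoint operator on $l^2(V)$. *)

(* Defs.v *)
From mathcomp Require Import all_boot all_algebra.
From mathcomp Require Import all_classical all_reals all_analysis.
From mathcomp.real_closed Require Import complex.
Set Implicit Arguments. Unset Strict Implicit. Unset Printing Implicit Defensive.
Import GRing.Theory Num.Theory.
Local Open Scope classical_set_scope.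
Local Open Scope ring_scope.

(* Vertices of the infinite N-ary tree: finite words over the alphabet 'I_N
   (letters 0..N-1 stand for 1..N).  Children of w are [rcons w i];
   the parent of a nonempty word drops its last letter. *)
Definition parent (N : nat) (w : seq 'I_N) : seq 'I_N := take (size w).-1 w.

Definition tree_laplacian (R : realType) (N : nat) (v : seq 'I_N -> R[i])
  : seq 'I_N -> R[i] :=
  fun w => (\sum_(i < N) (v w - v (rcons w i)) +
            (if w is [::] then 0 else v w - v (parent w)))%R.

Definition cnorm2 (R : realType) (z : R[i]) : R :=
  complex.Re z ^+ 2 + complex.Im z ^+ 2.

Definition l2norm2 (R : realType) (X : choiceType) (f : X -> R[i]) : \bar R :=
  \esum_(x in [set: X]) (cnorm2 (f x))%:E.
Definition in_l2 (R : realType) (X : choiceType) (f : X -> R[i]) : Prop :=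
  (l2norm2 f < +oo)%E.

Definition L2norm2 (R : realType) (w : R -> R) (g : R -> R[i]) : \bar R :=
  \int[lebesgue_measure]_(x in `[-1%R, 1%R]) (cnorm2 (g x) * w x)%:E.

Definition dsum_norm2 (R : realType) (I : choiceType) (w : I -> R -> R)
  (g : I -> R -> R[i]) : \bar R :=
  \esum_(n in [set: I]) L2norm2 (w n) (g n).
Definition in_dsum (R : realType) (I : choiceType) (w : I -> R -> R)
  (g : I -> R -> R[i]) : Prop :=
  (forall n, measurable_fun (`[-1, 1] : set R) (fun x => complex.Re (g n x)) /\
             measurable_fun (`[-1, 1] : set R) (fun x => complex.Im (g n x))) /\
  (dsum_norm2 w g < +oo)%E.

(* A : l^2(X) -> l^2(X) is unitarily equivalent to multiplication by m on
   the direct sum of the L^2(w_n dx) : there is a map U (defined on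
   representatives, everything on the target side up to null functions)
   that is C-linear, isometric, onto, and intertwines A with M_m. *)
Definition unitarily_equiv_mult (R : realType) (X I : choiceType)
  (A : (X -> R[i]) -> (X -> R[i])) (w : I -> R -> R) (m : R -> R) : Prop :=
  exists U : (X -> R[i]) -> (I -> R -> R[i]),
    [/\ forall f, in_l2 f -> in_dsum w (U f),
        forall (a : R[i]) f h, in_l2 f -> in_l2 h ->
          dsum_norm2 w (fun n x => U (fun y => a * f y + h y) n x
                                   - (a * U f n x + U h n x)) = 0%E,
        forall f, in_l2 f -> dsum_norm2 w (U f) = l2norm2 f,
        forall g, in_dsum w g ->
          exists2 f, in_l2 f & dsum_norm2 w (fun n x => U f n x - g n x) = 0%E
      & forall f, in_l2 f ->
          dsum_norm2 w (fun n x => U (A f) n x - (m x)%:C%C * U f n x) = 0%E].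

Definition w_c (R : realType) (x : R) : R := 2 / pi * Num.sqrt (1 - x ^+ 2).
Definition w_cp (R : realType) (N : nat) (x : R) : R :=
  w_c x / (1 - 2 * (Num.sqrt N%:R)^-1 * x + N%:R^-1).

(* Main.v *)
Require Import Defs.
From mathcomp Require Import all_boot all_order all_algebra.
From mathcomp Require Import all_classical all_reals all_analysis.
From mathcomp.real_closed Require Import complex.
From mathcomp Require Import measurable_realfun ring lra zify.
Import Order.TTheory GRing.Theory Num.Theory.
Import numFieldNormedType.Exports.
Set Implicit Arguments. Unset Strict Implicit. Unset Printing Implicit Defensive.
Local Open Scope classical_set_scope.
Local Open Scope ring_scope.

(** Fix a vertex [w] and a zero-sum vector on its [N] children. The functions that,
    on each child subtree, are radial and proportional to the corresponding entry
    form an invariant subspace on which the Laplacian is the Jacobi matrix with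
    diagonal [N + 1] and off-diagonal [- sqrt N]; on the globally radial functions the
    Jacobi matrix is the same except for its first diagonal entry [N], because the root
    has no parent. A Householder reflection at every vertex provides the orthonormal
    basis adapted to this decomposition of [l^2(V)]. With [a = 0] on the first kind of
    subspace and [a = N^(-1/2)] on the second, these matrices are multiplication by
    [N + 1 - 2 sqrt N x] in the basis [U_k - a U_(k-1)], where [U_k] are the Chebyshev
    polynomials of the second kind. This basis is orthonormal for the weight
    [w_c / (1 - 2 a x + a^2)]: since [w_c] is this weight times its denominator, the
    integrals of [U_k - a U_(k-1)] vanish for [k > 0], and orthonormality follows from
    the three-term recurrence. It is complete because polynomials approximate step
    functions boundedly and pointwise. *)

(** * Radial decomposition of functions on the tree *)

Section tree_transform.
Context {R : realType} (M : nat).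
Local Notation N := M.+1.
Local Notation V := (seq 'I_N).
Implicit Types (f : V -> R) (w : V).

Definition isqrtN : R := (Num.sqrt N%:R)^-1.
Local Notation s := isqrtN.

Lemma sqrtN_gt0 : 0 < Num.sqrt N%:R :> R.
Proof. by rewrite sqrtr_gt0 ltr0n. Qed.

Lemma isqrtN_gt0 : 0 < s.
Proof. by rewrite invr_gt0 sqrtN_gt0. Qed.

Lemma sqrtNE : Num.sqrt N%:R = s^-1 :> R.
Proof. by rewrite invrK. Qed.

Lemma isqrtN_sqr : s ^+ 2 = N%:R^-1.
Proof. by rewrite exprVn sqr_sqrtr. Qed.

Lemma natNE : N%:R = s ^- 2 :> R.
Proof. by rewrite isqrtN_sqr invrK. Qed.

Lemma isqrtN_le1 : s <= 1.
Proof. by rewrite invf_le1 ?sqrtN_gt0// -[leLHS]sqrtr1 ler_sqrt// ler1n. Qed.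

Lemma isqrtN_lt1 : (0 < M)%N -> s < 1.
Proof. by move=> M0; rewrite invf_lt1 ?sqrtN_gt0// -[ltLHS]sqrtr1 ltr_sqrt// ltr1n. Qed.

(* The Householder reflection that exchanges the first basis vector with the
   normalised constant vector. *)
Definition householder (x : 'I_N -> R) (i : 'I_N) : R :=
  if i == ord0 then s * \sum_j x j
  else x i + s / (1 - s) * (x ord0 - s * \sum_j x j).

Lemma sum_ordS (x : 'I_N -> R) : \sum_i x i = x ord0 + \sum_(j < M) x (lift ord0 j).
Proof. by rewrite big_ord_recl. Qed.

Lemma householder0 x : householder x ord0 = s * \sum_j x j.
Proof. by []. Qed.

Lemma householder_lift x j : householder x (lift ord0 j) =
  x (lift ord0 j) + s / (1 - s) * (x ord0 - s * \sum_j x j).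
Proof. by rewrite /householder eq_sym (negbTE (neq_lift _ _)). Qed.

Lemma natME : M%:R = s ^- 2 - 1 :> R.
Proof. by rewrite -natNE -natr1 addrK. Qed.

(** The reflection is symmetric and sends the all-ones vector to [s^-1] times the first basis
    vector; pairing [householder x] with the all-ones vector gives the value. *)
Lemma sum_householder x : \sum_i householder x i = x ord0 / s.
Proof.
have s0 := lt0r_neq0 isqrtN_gt0.
rewrite sum_ordS; under eq_bigr do rewrite householder_lift; rewrite householder0.
rewrite big_split/= sumr_const card_ord -[_ *+ M]mulr_natr natME sum_ordS.
set y := \sum_(j < M) _.
(* For [N = 1] one has [s = 1], and [s / (1 - s)] takes the default value [0]; this case is computed
   apart. *)
have [M0|M0] := posnP M.
  have -> : y = 0 by rewrite /y big1// => -[j jM]; exfalso; move: jM; rewrite M0.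
  have -> : s = 1 by rewrite /isqrtN M0 sqrtr1 invr1.
  by rewrite subrr invr0 ?expr1n ?invr1; ring.
have s1 : 1 - s != 0 by rewrite subr_eq0 gt_eqF// isqrtN_lt1.
by field; rewrite s0.
Qed.

Lemma householderK x : householder (householder x) =1 x.
Proof.
have s0 := lt0r_neq0 isqrtN_gt0.
move=> i; case: (unliftP ord0 i) => [j|] ->;
  last by rewrite householder0 sum_householder mulrC divfK.
rewrite householder_lift householder_lift sum_householder householder0.
have s1 : 1 - s != 0.
  by rewrite subr_eq0 gt_eqF// isqrtN_lt1//; case: j => j /=; case: (M).
by field; rewrite s0.
Qed.

Lemma householder_sqr x : \sum_i householder x i ^+ 2 = \sum_i x i ^+ 2.
Proof.
have s0 := lt0r_neq0 isqrtN_gt0.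
rewrite sum_ordS; under eq_bigr do rewrite householder_lift sqrrD; rewrite householder0.
rewrite !big_split/= sumr_const card_ord -[_ *+ M]mulr_natr natME.
rewrite -!mulr_suml !sum_ordS.
set y := \sum_(j < M) x _; set z := \sum_(j < M) _ ^+ 2.
have [M0|M0] := posnP M.
  have -> : y = 0 by rewrite /y big1// => -[j jM]; exfalso; move: jM; rewrite M0.
  have -> : s = 1 by rewrite /isqrtN M0 sqrtr1 invr1.
  by rewrite subrr invr0 ?expr1n ?invr1; ring.
have s1 : 1 - s != 0 by rewrite subr_eq0 gt_eqF// isqrtN_lt1.
by field; rewrite s0.
Qed.

(** The constant [c] disappears because every row but the first is orthogonal to constants. This
    later removes the value at the common parent from the Laplacian on the children. *)
Lemma householder_lin (a b c : R) (x y : 'I_N -> R) j :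
  householder (fun i => a * x i + b * y i + c) (lift ord0 j) =
  a * householder x (lift ord0 j) + b * householder y (lift ord0 j).
Proof.
rewrite !householder_lift !big_split/= sumr_const card_ord -[_ *+ N]mulr_natr natNE.
rewrite -!mulr_sumr.
have s0 := lt0r_neq0 isqrtN_gt0.
have s1 : 1 - s != 0.
  by rewrite subr_eq0 gt_eqF// isqrtN_lt1//; case: j => j /=; case: (M).
by field; rewrite ?s0 ?s1.
Qed.

(** Unfolds to [N^(-k/2)] times the sum of [f] over the descendants of [w] at distance [k]: the
    inner product with the normalised indicator of that generation. *)
Fixpoint level_avg (k : nat) (f : V -> R) (w : V) : R :=
  if k is k'.+1 then s * \sum_(i < N) level_avg k' f (rcons w i) else f w.

(* [None] indexes the radial functions; [Some (w, j)] those supported below [w]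
   that are radial on each child subtree with zero sum over the children. *)
Definition tree_index : choiceType := option (V * 'I_M).

Definition tree_coef (f : V -> R) (n : tree_index) (k : nat) : R :=
  if n is Some (w, j) then householder (fun i => level_avg k f (rcons w i)) (lift ord0 j)
  else level_avg k f [::].

(** The reflection preserves the norm of the vector of child averages: its first entry is the
    average seen from [w], the others are the coefficients branching at [w]. *)
Lemma level_avg_split f w k :
  \sum_i level_avg k f (rcons w i) ^+ 2 =
  level_avg k.+1 f w ^+ 2 + \sum_(j < M) tree_coef f (Some (w, j)) k ^+ 2.
Proof. by rewrite -householder_sqr sum_ordS householder0. Qed.

(* The word is read backwards, so that its head is the last letter. *)
Fixpoint tree_rebuild_rev (c : tree_index -> nat -> R) (u : V) (k : nat) : R :=
  if u is i :: u' then
    householder (fun j => if unlift ord0 j is Some j' then c (Some (rev u', j')) k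
                 else tree_rebuild_rev c u' k.+1) i
  else c None k.

Definition tree_rebuild c w := tree_rebuild_rev c (rev w) 0.

(** The reconstruction carries all level averages along, not only the values ([k = 0]). As
    [householder] is an involution, reflecting the child averages returns the average prescribed at
    the parent. *)
Lemma level_avg_rebuild c k w : level_avg k (tree_rebuild c) w = tree_rebuild_rev c (rev w) k.
Proof.
elim: k w => [//|k IH] w /=.
under eq_bigr do rewrite IH rev_rcons/=.
by rewrite -householder0 householderK unlift_none.
Qed.

Lemma tree_coef_rebuild c n k : tree_coef (tree_rebuild c) n k = c n k.
Proof.
case: n => [[w j]|] /=; last by rewrite level_avg_rebuild.
rewrite (_ : (fun i => _) = householder (fun j => if unlift ord0 j is Some j' then c (Some
  (w, j')) k
                 else tree_rebuild_rev c (rev w) k.+1)); first by rewrite householderK liftK.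
by apply/funext => i; rewrite level_avg_rebuild rev_rcons/= revK.
Qed.

Lemma level_avg_lin (a : R) f h k w :
  level_avg k (fun v => a * f v + h v) w = a * level_avg k f w + level_avg k h w.
Proof.
elim: k w => [//|k IH] w /=.
under eq_bigr do rewrite IH.
by rewrite big_split/= -mulr_sumr; ring.
Qed.

Lemma tree_coef_lin (a : R) f h n k :
  tree_coef (fun v => a * f v + h v) n k = a * tree_coef f n k + tree_coef h n k.
Proof.
case: n => [[w j]|] /=; last exact: level_avg_lin.
rewrite -[X in _ = _ + X]mul1r -(householder_lin _ _ 0); congr householder.
by apply/funext => i; rewrite level_avg_lin mul1r addr0.
Qed.

Definition rlaplacian (f : V -> R) w : R :=
  \sum_(i < N) (f w - f (rcons w i)) +
  (if w is [::] then 0 else f w - f (parent w)).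

Lemma parent_rcons w (i : 'I_N) : parent (rcons w i) = w.
Proof. by rewrite /parent size_rcons/= -cats1 take_size_cat. Qed.

Lemma rlaplacian_rcons f w i : rlaplacian f (rcons w i) =
  (N%:R + 1) * f (rcons w i) - s^-1 * level_avg 1 f (rcons w i) - f w.
Proof.
rewrite /rlaplacian parent_rcons.
case E : (rcons w i) => [|u v]; first by case: w E.
rewrite -E sumrB sumr_const card_ord -[_ *+ N]mulr_natr/=.
by rewrite mulrA mulVf ?lt0r_neq0 ?isqrtN_gt0//; ring.
Qed.

Lemma rlaplacian_nil f : rlaplacian f [::] = N%:R * f [::] - s^-1 * level_avg 1 f [::].
Proof.
rewrite /rlaplacian addr0 sumrB sumr_const card_ord -[_ *+ N]mulr_natr/=.
by rewrite mulrA mulVf ?lt0r_neq0 ?isqrtN_gt0//; ring.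
Qed.

Lemma level_avgS f k w : level_avg k.+1 f w = s * \sum_(i < N) level_avg k f (rcons w i).
Proof. by []. Qed.

(** Vertices one or more generations below [w] all have a parent, so no boundary term occurs. Each
    parent is counted once per child, and [s * N = s^-1] gives the symmetric off-diagonal
    coefficient. *)
Lemma level_avg_rlaplacian f k w : level_avg k.+1 (rlaplacian f) w =
  (N%:R + 1) * level_avg k.+1 f w - s^-1 * level_avg k.+2 f w - s^-1 * level_avg k f w.
Proof.
elim: k w => [|k IH] w.
  rewrite [LHS]/=; under eq_bigr do rewrite rlaplacian_rcons.
  rewrite !sumrB -[X in _ * (X - _ - _)]mulr_sumr -[X in _ *
    (_ - X - _)]mulr_sumr sumr_const card_ord -[f w *+ N]mulr_natr natNE.
  rewrite (level_avgS f 1) (level_avgS f 0 w) -[level_avg 0 f]/f; field;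
    exact: lt0r_neq0 isqrtN_gt0.
rewrite level_avgS; under eq_bigr do rewrite IH.
rewrite !sumrB -[X in _ * (X - _ - _)]mulr_sumr -[X in _ * (_ - X - _)]mulr_sumr.
by rewrite -[X in _ * (_ - X)]mulr_sumr (level_avgS f k.+2) (level_avgS f k.+1 w)
  (level_avgS f k w); ring.
Qed.

(* [b] is [1] for the radial functions, the root having no parent, and [0] for
   the other subspaces. *)
Definition jacobi (b : R) (c : nat -> R) (k : nat) : R :=
  (N%:R + 1) * c k - s^-1 * c k.+1 - (if k is k'.+1 then s^-1 * c k' else b * c 0%N).

Lemma tree_coef_rlaplacian f n k :
  tree_coef (rlaplacian f) n k = jacobi (if n is None then 1 else 0) (tree_coef f n) k.
Proof.
case: n => [[w j]|].
- case: k => [|k].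
    (* At [k = 0] the vertices are the children of [w]; their parent terms are all [- f w], a
       constant vector that [householder_lin] kills. *)
    rewrite /jacobi /tree_coef/= mul0r subr0 -mulNr -(householder_lin _ _ (- f w));
      congr householder.
    by apply/funext => i; rewrite rlaplacian_rcons/= mulNr.
  rewrite /jacobi /tree_coef.
  have -> : (fun i => level_avg k.+1 (rlaplacian f) (rcons w i)) = (fun i =>
      1 * ((N%:R + 1) * level_avg k.+1 f (rcons w i) + (- s^-1) * level_avg k.+2 f (rcons w i) +
        0) +
      (- s^-1) * level_avg k f (rcons w i) + 0).
    by apply/funext => i; rewrite level_avg_rlaplacian; ring.
  by rewrite householder_lin householder_lin; ring.
- rewrite /tree_coef /jacobi; case: k => [|k]; last by rewrite level_avg_rlaplacian.
  by rewrite [LHS]/= rlaplacian_nil/=; ring.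
Qed.

End tree_transform.

(** * Parseval identity for the tree coefficients *)

Lemma esum_fiber {R : realType} (T : choiceType) (g : T -> nat) (a : T -> \bar R) :
  (forall x, 0 <= a x)%E ->
  \esum_(x in [set: T]) a x =
  \esum_(L in [set: nat]) \esum_(x in [set x | g x = L]) a x.
Proof.
move=> a0; rewrite -esum_bigcupT//; first by rewrite bigcup_mkcond; congr esum;
  apply/seteqP; split => // x _; exists (g x) => //; rewrite ifT// inE.
by move=> i j _ _ [x [/= <- <-]].
Qed.

Lemma esum_fin {R : realType} (T : finType) (a : T -> \bar R) :
  (forall x, 0 <= a x)%E -> \esum_(x in [set: T]) a x = (\sum_x a x)%E.
Proof.
move=> a0; rewrite esum_fset//; last exact: finite_finset.
rewrite (_ : [set: T] = [set` enum T]); first by rewrite -fsbig_seq ?enum_uniq// big_enum.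
by apply/seteqP; split => x //= _; rewrite mem_enum.
Qed.

Lemma esum_pair {R : realType} (T1 T2 : choiceType) (A : set T1) (a : T1 * T2 -> \bar R) :
  (forall x, 0 <= a x)%E ->
  \esum_(p in [set p | A p.1]) a p = \esum_(x in A) \esum_(y in [set: T2]) a (x, y).
Proof.
move=> a0; rewrite (@esum_esum _ _ _ A (fun=> setT) (fun x y => a (x, y)))//.
rewrite (_ : A `*`` _ = [set p | A p.1]); first by apply: eq_esum => -[].
by apply/seteqP; split => [[x y] []|].
Qed.

Section parseval.
Context {R : realType} (M : nat).
Local Notation N := M.+1.
Local Notation V := (seq 'I_N).
Variable f : V -> R.

Let sqE_ge0 (x : R) : (0 <= (x ^+ 2)%:E)%E.
Proof. by rewrite lee_fin sqr_ge0. Qed.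

Let Q L k := \esum_(w in [set w : V | size w = L]) (level_avg k f w ^+ 2)%:E.

Let QS L k : Q L.+1 k = (Q L k.+1 +
  \esum_(p in [set p : V * 'I_M | size p.1 = L]) (tree_coef f (Some p) k ^+ 2)%:E)%E.
Proof.
pose A := [set w : V | size w = L].
rewrite [X in (_ + X)%E](@esum_pair _ _ _ A (fun p => (tree_coef f (Some p) k ^+ 2)%:E))//.
rewrite /Q -esumD//; last by move=> w _; exact: esum_ge0.
rewrite (reindex_esum [set p : V * 'I_N | A p.1] _ (fun p => rcons p.1 p.2)); last first.
  split.
  - by move=> [w i] /= Aw; rewrite size_rcons; congr S.
  - by move=> [w i] [w' i'] _ _ /= /rcons_inj[-> ->].
  - move=> w /=; elim/last_ind: w => [//|w i _] /=; rewrite size_rcons => -[wL].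
    by exists (w, i).
rewrite (@esum_pair _ _ _ A (fun p => (level_avg k f (rcons p.1 p.2) ^+ 2)%:E))//.
apply: eq_esum => w _; rewrite !esum_fin// sumEFin [in RHS]sumEFin -EFinD.
by rewrite level_avg_split.
Qed.

(** The coefficients living at tree level [L + k0] that branch strictly above level [L]; those
    branching lower are averaged out in [Q L k0]. The component of [Some (w, j)] starts at the
    children of [w], whence [x.2.+1]. *)
Let S L k0 := [set x : tree_index M * nat | match x.1 with
  | None => x.2 = (L + k0)%N
  | Some p => (size p.1 < L /\ size p.1 + x.2.+1 = L + k0)%N end].

Let QE L k0 : Q L k0 = \esum_(x in S L k0) (tree_coef f x.1 x.2 ^+ 2)%:E.
Proof.
elim: L k0 => [|L IH] k0.
  have -> : S 0 k0 = [set (None, k0)].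
    by apply/seteqP; split => [[[p|] k]|_ ->]; rewrite /S//=; [case|move=> ->].
  rewrite esum_set1// /Q [X in esum X](_ : _ = [set [::]]) ?esum_set1//.
  by apply/seteqP; split => [[]//|_ ->].
rewrite QS IH.
(* [B] isolates the indices branching at level [L], the only ones of [S L.+1 k0] absent from
   [S L k0.+1]. *)
pose B := [set x : tree_index M * nat | if x.1 is Some p then size p.1 = L else False].
rewrite (esumID B (S L.+1 k0))// addeC; congr (_ + _)%E.
  rewrite [RHS](reindex_esum [set p : V * 'I_M | size p.1 = L] _ (fun p => (Some p, k0)))//.
  split.
  - by move=> [w j] /= wL; rewrite /S /B/= wL; split => //; split;
    [exact: ltnSn|rewrite addnS addSn].
  - by move=> p q _ _ [].
  - move=> [[p|] k]; rewrite /S /B/= => -[] // [_ + pL]; rewrite pL => pk.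
    by exists p => //; congr (_, _); lia.
congr esum; apply/seteqP; rewrite /S /B; split => [[[p|] k]|[[p|] k] []]//=; lia.
Qed.

(** Both sums are sorted by tree level. [Q L 0] is the energy of [f] on level [L], and the condition
    [size p.1 < L] in [S L 0] holds automatically. *)
Lemma tree_parseval : \esum_(w in [set: V]) (f w ^+ 2)%:E =
  \esum_(n in [set: tree_index M]) \esum_(k in [set: nat]) (tree_coef f n k ^+ 2)%:E.
Proof.
rewrite -(@esum_pair _ _ _ setT (fun p : tree_index M * nat => (tree_coef f p.1 p.2 ^+ 2)%:E))//.
rewrite (esum_fiber (@size _))//.
rewrite (esum_fiber (fun x : tree_index M * nat =>
  if x.1 is Some p then (size p.1 + x.2.+1)%N else x.2))//.
apply: eq_esum => L _; rewrite -[LHS]/(Q L 0) QE; congr esum.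
by apply/seteqP; split => [[[p|] k]|[[p|] k]]; rewrite /S/=; lia.
Qed.

End parseval.

(** * Riesz-Fischer *)

Section has_integral.
Context d (T : measurableType d) (R : realType) (mu : {measure set T -> \bar R}).
Variables (D : set T) (mD : measurable D).
Implicit Types (f g : T -> R) (u v : R).

Definition has_integral f v :=
  mu.-integrable D (EFin \o f) /\ (\int[mu]_(x in D) (f x)%:E = v%:E)%E.

Lemma has_integral_measurable f v : has_integral f v -> measurable_fun D f.
Proof. by case=> /integrableP[/measurable_EFinP]. Qed.

Lemma has_integral_eq f g v : (forall x, D x -> f x = g x) -> has_integral f v -> has_integral g v.
Proof.
move=> fg [fi fv]; split.
  by apply: eq_integrable fi => // x /[!inE] Dx /=; rewrite fg.
by rewrite -fv; apply: eq_integral => x /[!inE] Dx; rewrite fg.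
Qed.

Lemma integrable_has_integral f : mu.-integrable D (EFin \o f) -> exists v, has_integral f v.
Proof.
move=> fi; exists (fine (\int[mu]_(x in D) (f x)%:E)%E); split => //.
by rewrite fineK//; exact: integrable_fin_num.
Qed.

Lemma has_integral_lin (a : R) f g u v : has_integral f u -> has_integral g v ->
  has_integral (fun x => a * f x + g x) (a * u + v).
Proof.
move=> [fi fu] [gi gv].
have afi : mu.-integrable D (fun x => a%:E * (EFin \o f) x)%E by exact: integrableZl.
split; first by have := integrableD mD afi gi; exact: eq_integrable.
by rewrite EFinD EFinM -fu -gv -integralZl// -integralD.
Qed.

Lemma has_integral0 : has_integral (fun=> 0) 0.
Proof. by split; [exact: integrable0|rewrite integral0_eq]. Qed.

Lemma has_integralZ (a : R) f u : has_integral f u -> has_integral (fun x => a * f x) (a * u).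
Proof.
by move=> fu; have := has_integral_lin a fu has_integral0; rewrite addr0;
  apply: has_integral_eq => x _; rewrite addr0.
Qed.

Lemma has_integralD f g u v : has_integral f u -> has_integral g v -> has_integral (fun x =>
  f x + g x) (u + v).
Proof.
by move=> fu gv; have := has_integral_lin 1 fu gv; rewrite mul1r; apply: has_integral_eq => x _;
  rewrite mul1r.
Qed.

Lemma has_integral_sum n (F : nat -> T -> R) (v : nat -> R) :
  (forall k, (k < n)%N -> has_integral (F k) (v k)) ->
  has_integral (fun x => \sum_(k < n) F k x) (\sum_(k < n) v k).
Proof.
elim: n => [|n IH] Fv.
  by rewrite big_ord0; apply: has_integral_eq has_integral0 => x _; rewrite big_ord0.
rewrite big_ord_recr/=; apply: (has_integral_eq (f := fun x => \sum_(k < n) F k x + F n x)).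
  by move=> x _; rewrite big_ord_recr.
by apply: has_integralD; [apply: IH => k kn; apply: Fv; rewrite ltnS ltnW|exact: Fv].
Qed.

Lemma has_integral_ge0 f v : (forall x, D x -> 0 <= f x) -> has_integral f v -> 0 <= v.
Proof.
move=> f0 [_ fv]; rewrite -lee_fin -fv.
by apply: integral_ge0 => x Dx; rewrite lee_fin f0.
Qed.

Lemma has_integral_dom f g v : measurable_fun D f -> (forall x, D x -> `|f x| <= g x) ->
  has_integral g v -> exists u, has_integral f u.
Proof.
move=> mf fg [gi _]; apply: integrable_has_integral.
apply: le_integrable gi => //; first exact/measurable_EFinP.
by move=> x Dx; rewrite lee_fin (le_trans (fg _ Dx))// ler_norm.
Qed.

Lemma has_integral_mulL2 f g u v : measurable_fun D f -> measurable_fun D g ->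
  has_integral (fun x => f x ^+ 2) u -> has_integral (fun x => g x ^+ 2) v ->
  exists s, has_integral (fun x => f x * g x) s.
Proof.
move=> mf mg fu gv; apply: has_integral_dom (has_integralD fu gv).
  exact: measurable_funM.
move=> x _; rewrite ler_norml.
have := sqr_ge0 (f x - g x); have := sqr_ge0 (f x + g x).
have := sqr_ge0 (f x); have := sqr_ge0 (g x).
by rewrite sqrrD sqrrB; lra.
Qed.

Lemma has_integral_ge0_fin f : measurable_fun D f -> (forall x, D x -> 0 <= f x) ->
  (\int[mu]_(x in D) (f x)%:E < +oo)%E -> exists v, has_integral f v.
Proof.
move=> mf f0 foo; apply: integrable_has_integral; apply/integrableP; split.
  exact/measurable_EFinP.
rewrite (_ : integral _ _ _ = (\int[mu]_(x in D) (f x)%:E)%E)//.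
by apply: eq_integral => x /[!inE] Dx /=; rewrite ger0_norm// f0.
Qed.

Lemma has_integral_dct (f_ : nat -> T -> R) (v_ : nat -> R) f v (g : T -> \bar R) :
  (forall n, has_integral (f_ n) (v_ n)) -> measurable_fun D f ->
  {ae mu, forall x, D x -> f_ ^~ x @ \oo --> f x} ->
  mu.-integrable D g ->
  {ae mu, forall x n, D x -> (`|f_ n x|%:E <= g x)%E} ->
  v_ @ \oo --> v -> has_integral f v.
Proof.
move=> fv mf fcvg gi fg vv.
have [] := @dominated_convergence _ T R mu D mD (fun n => EFin \o f_ n) (EFin \o f) g.
- by move=> n; apply/measurable_EFinP; exact: has_integral_measurable (fv n).
- exact/measurable_EFinP.
- by apply: filterS fcvg => x /[apply] fx; apply: cvg_EFin => //; exact: nearW.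
- by [].
- by apply: filterS fg => x + n Dx; exact.
move=> fi _ /= cv; split => //; apply: cvg_unique cv _ => //.
rewrite (_ : (fun _ => _) = EFin \o v_); first by apply: cvg_EFin => //; exact: nearW.
by apply/funext => n /=; have [_ ->] := fv n.
Qed.

End has_integral.

(** Cauchy-Schwarz with weights [2^j], whose inverses sum to at most [2]. *)
Lemma weighted_cauchy_schwarz {R : realFieldType} (d : nat -> R) n :
  (\sum_(j < n) d j) ^+ 2 <= 2 * \sum_(j < n) 2 ^+ j * d j ^+ 2.
Proof.
(* The induction is run with the exact partial sum of the inverse weights, [2 - 2 * 2^-n]. *)
suff : (\sum_(j < n) d j) ^+ 2 <= (2 - 2 * 2^-1 ^+ n) * \sum_(j < n) 2 ^+ j * d j ^+ 2.
  move=> /le_trans; apply; apply: ler_wpM2r.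
    by apply: sumr_ge0 => j _; rewrite mulr_ge0 ?sqr_ge0// exprn_ge0.
  by rewrite lerBlDr lerDl mulr_ge0// exprn_ge0.
elim: n => [|n IH]; first by rewrite !big_ord0 expr0n/= mulr0.
rewrite !big_ord_recr/=; move: IH.
set A := \sum_(i < n) d i; set S := \sum_(i < n) _.
have S0 : 0 <= S by apply: sumr_ge0 => j _; rewrite mulr_ge0 ?sqr_ge0// exprn_ge0.
have p0 : 0 < 2 ^+ n :> R by rewrite exprn_gt0.
rewrite [2^-1 ^+ n.+1]exprS exprVn; set p : R := 2 ^+ n; set t := p^-1.
have pt : p * t = 1 by rewrite divff// gt_eqF.
have t0 : 0 < t by rewrite invr_gt0.
have t1 : t <= 1 by rewrite invf_le1// exprn_ege1// ler1n.
set q := p * d n ^+ 2.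
have q0 : 0 <= q by rewrite mulr_ge0 ?sqr_ge0// ltW.
have dq : d n ^+ 2 = t * q by rewrite /q mulrA [t * p]mulrC pt mul1r.
clearbody p t q S A => IH.
have w0 : 0 <= 2 - 2 * t by lra.
have -> : 2 - 2 * (2^-1 * t) = (2 - 2 * t) + t by field.
move: w0 IH; set w := 2 - 2 * t; clearbody w => w0 IH.
(* The cross term is bounded by the arithmetic-geometric mean inequality for [w * q] and [t * S]. *)
have H : (2 * A * d n) ^+ 2 <= (w * q + t * S) ^+ 2.
  have -> : (2 * A * d n) ^+ 2 = 4 * A ^+ 2 * (t * q) by rewrite -dq; ring.
  apply: (@le_trans _ _ (4 * (w * S) * (t * q))).
    by apply: ler_wpM2r; [rewrite mulr_ge0// ltW|apply: ler_wpM2l].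
  by rewrite -subr_ge0 [leRHS](_ : _ = (w * q - t * S) ^+ 2) ?sqr_ge0//; ring.
have K : 0 <= w * q + t * S by rewrite addr_ge0// mulr_ge0// ltW.
have : 2 * A * d n <= w * q + t * S.
  by rewrite (le_trans (ler_norm _))// -ler_sqr ?nnegrE// real_normK ?num_real.
by move=> H2; rewrite sqrrD dq; nra.
Qed.

Section riesz_fischer.
Context d (T : measurableType d) (R : realType) (mu : {measure set T -> \bar R}).
Variables (D : set T) (mD : measurable D) (e : nat -> T -> R).
Hypothesis me : forall k, measurable_fun D (e k).
Hypothesis eo : forall j k, has_integral mu D (fun x => e j x * e k x) (j == k)%:R.
Local Notation has_integral := (has_integral mu D).

Variable c : nat -> R.
Let psum n x := \sum_(k < n) c k * e k x.
Let sig n := \sum_(k < n) c k ^+ 2.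

Let mpsum n : measurable_fun D (psum n).
Proof.
by apply: measurable_sum => k; apply: measurable_funM => //; exact: measurable_cst.
Qed.

Let psum_e n k : has_integral (fun x => psum n x * e k x) (if (k < n)%N then c k else 0).
Proof.
have -> : (if (k < n)%N then c k else 0) = \sum_(j < n) c j * (j == k :> nat)%:R.
  case: ltnP => kn; last first.
    by rewrite big1// => j _; rewrite ltn_eqF ?mulr0// (leq_trans (ltn_ord j)).
  rewrite (bigD1 (Ordinal kn))//= eqxx mulr1 big1 ?addr0// => j.
  by rewrite -val_eqE/= => /negbTE ->; rewrite mulr0.
apply: (has_integral_eq mD (f := fun x => \sum_(j < n) c j * (e j x * e k x))).
  by move=> x _; rewrite mulr_suml; apply: eq_bigr => j _; rewrite mulrA.
by apply: (has_integral_sum mD (F := fun j x => c j * (e j x * e k x))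
  (v := fun j => c j * (j == k)%:R)) => j _; exact: has_integralZ.
Qed.

Let psum_psum m n : (m <= n)%N -> has_integral (fun x => psum m x * psum n x) (sig m).
Proof.
move=> mn; apply: (has_integral_eq mD (f := fun x => \sum_(k < m) c k * (psum n x * e k x))).
  by move=> x _; rewrite mulr_suml; apply: eq_bigr => j _; ring.
apply: (has_integral_sum mD (F := fun k x => c k * (psum n x * e k x))
  (v := fun k => c k ^+ 2)) => k km.
have := has_integralZ mD (c k) (psum_e n k); rewrite (leq_trans km mn) -expr2.
exact.
Qed.

(** Expand the nonnegative integral of [(g - psum n)^2]: the mixed product and the squared partial
    sum both integrate to [sig n]. *)
Lemma bessel g v : has_integral (fun x => g x ^+ 2) v ->
  (forall k, has_integral (fun x => g x * e k x) (c k)) -> forall n, sig n <= v.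
Proof.
move=> gv gc n.
have h : has_integral (fun x => g x * psum n x) (sig n).
  apply: (has_integral_eq mD (f := fun x => \sum_(k < n) c k * (g x * e k x))).
    by move=> x _; rewrite mulr_sumr; apply: eq_bigr => j _; ring.
  by apply: (has_integral_sum mD (F := fun k x => c k * (g x * e k x))
    (v := fun k => c k ^+ 2)) => k _; rewrite expr2; exact: has_integralZ.
have := has_integral_lin mD (-2) h (has_integralD mD gv (psum_psum (leqnn n))).
move=> /(has_integral_ge0 (mu := mu)) H; rewrite -subr_ge0.
have -> : v - sig n = -2 * sig n + (v + sig n) by ring.
apply: H => x _.
have -> : -2 * (g x * psum n x) + (g x ^+ 2 + psum n x * psum n x) = (g x - psum n x) ^+ 2 by ring.
exact: sqr_ge0.
Qed.

Variable B : R.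
Hypothesis cB : forall n, sig n <= B.

Let sig_nd : {homo sig : m n / (m <= n)%N >-> m <= n}.
Proof.
apply: homo_leq => //; first by move=> y x z; exact: le_trans.
by move=> n; rewrite /sig big_ord_recr/= lerDl sqr_ge0.
Qed.

Let ell := sup (range sig).

Let sig_cvg : sig @ \oo --> ell.
Proof. by apply: nondecreasing_cvgn => //; exists B => _ [n _ <-]. Qed.

Let sig_le n : sig n <= ell.
Proof.
rewrite /ell; apply: ub_le_sup; last by exists n.
by exists B => _ [k _ <-].
Qed.

Let tail j : {n | ell - sig n <= 4^-1 ^+ j}.
Proof.
apply: cid; have e0 : 0 < 4^-1 ^+ j :> R by rewrite exprn_gt0// invr_gt0.
have /cvgrPdist_le/(_ _ e0)[n _ /(_ n (leqnn n))] := sig_cvg.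
by move=> H; exists n; rewrite (le_trans (ler_norm _)).
Qed.

(** A strictly increasing subsequence along which the tails are at most [4^-j]; then [2^j] times the
    squared norm of the increments of [psum] is still summable. *)
Let nu := fix nu j := if j is j'.+1 then maxn (nu j').+1 (sval (tail j))
                      else sval (tail 0).

Let nu_tail j : ell - sig (nu j) <= 4^-1 ^+ j.
Proof.
case: j => [|j]; first exact: (svalP (tail 0)).
apply: le_trans (svalP (tail j.+1)); rewrite lerB// sig_nd//=; exact: leq_maxr.
Qed.

Let nuS j : (nu j < nu j.+1)%N.
Proof. exact: leq_maxl. Qed.

Let nu_ge j : (j <= nu j)%N.
Proof. by elim: j => // j IH; exact: leq_ltn_trans IH (nuS j). Qed.

Let h j := psum (nu j).
Let dh j x := h j.+1 x - h j x.

Let mdh j : measurable_fun D (dh j).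
Proof. exact: (measurable_funB (mpsum _) (mpsum _)). Qed.

Let hE n x : h n x = h 0%N x + \sum_(j < n) dh j x.
Proof.
elim: n => [|n IH]; first by rewrite big_ord0 addr0.
by rewrite big_ord_recr/= addrA -IH /dh addrC subrK.
Qed.

Let dh_int j : has_integral (fun x => dh j x ^+ 2) (sig (nu j.+1) - sig (nu j)).
Proof.
have := has_integral_lin mD (-2) (psum_psum (ltnW (nuS j)))
  (has_integralD mD (psum_psum (leqnn (nu j))) (psum_psum (leqnn (nu j.+1)))).
rewrite [X in has_integral _ X -> _](_ : _ = sig (nu j.+1) - sig (nu j)); last by ring.
by apply: has_integral_eq => // x _; rewrite /dh /h; ring.
Qed.

Let q j x := 2 ^+ j * dh j x ^+ 2.

Let q_ge0 j x : 0 <= q j x.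
Proof. by rewrite mulr_ge0 ?sqr_ge0// exprn_ge0. Qed.

Let mq j : measurable_fun D (EFin \o q j).
Proof.
apply/measurable_EFinP; apply: measurable_funM; first exact: measurable_cst.
exact: measurable_funX.
Qed.

(* [Q] is integrable, which makes the subsequence [h] of the partial sums converge
   almost everywhere, and by Cauchy-Schwarz it dominates all the [h j ^+ 2]. *)
Let Q x := (\sum_(j <oo) (q j x)%:E)%E.

Let Q_ge0 x : (0 <= Q x)%E.
Proof. by apply: nneseries_ge0 => j _ _; rewrite lee_fin. Qed.

Let Q_int : mu.-integrable D Q.
Proof.
apply/integrableP; split.
  apply: (@ge0_emeasurable_sum _ _ _ D (fun j => EFin \o q j) predT) => [j x _ _|j _].
    by rewrite lee_fin.
  exact: mq.
rewrite (_ : integral _ _ _ = \int[mu]_(x in D) Q x)%E; last first.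
  by apply: eq_integral => x _; rewrite gee0_abs.
rewrite integral_nneseries//; last by move=> j x _; rewrite lee_fin.
apply: (@le_lt_trans _ _ (\sum_(j <oo) (geometric 1 (2^-1) j)%:E)%E).
  apply: lee_nneseries => [j _ _|j _].
    by apply: integral_ge0 => x _; rewrite lee_fin.
  have [_ ->] := has_integralZ mD (2 ^+ j) (dh_int j).
  rewrite lee_fin/= mul1r.
  have -> : 2^-1 ^+ j = 2 ^+ j * 4^-1 ^+ j :> R by rewrite -exprMn; congr (_ ^+ _); field.
  apply: ler_wpM2l; first by rewrite exprn_ge0.
  by apply: le_trans (nu_tail j); rewrite lerB.
rewrite (_ : limn _ = (limn (series (geometric 1 (2^-1 : R))))%:E) ?ltry//.
rewrite -EFin_lim; last by apply: is_cvg_geometric_series; rewrite ger0_norm; lra.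
by congr (limn _); apply/funext => n /=; rewrite sumEFin.
Qed.

Let Q_ae : {ae mu, forall x, D x -> Q x \is a fin_num}.
Proof. exact: integrable_ae. Qed.

Let sumq_le x n : Q x \is a fin_num -> \sum_(j < n) q j x <= fine (Q x).
Proof.
move=> Qx; rewrite -lee_fin fineK// -sumEFin -(big_mkord xpredT (fun j => (q j x)%:E)).
by apply: nneseries_lim_ge => j _ _; rewrite lee_fin.
Qed.

(** The series of increments converges absolutely: [2 |d| <= 2^j d^2 + 2^-j], and both bounds are
    summable where [Q] is finite. *)
Let h_cvg x : Q x \is a fin_num -> cvgn (h ^~ x).
Proof.
move=> Qx; suff : cvgn (series (dh ^~ x)).
  move=> cs; rewrite (_ : h ^~ x = (fun n => h 0%N x + series (dh ^~ x) n)); last first.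
    by apply/funext => n; rewrite hE /series/= big_mkord.
  by apply: is_cvgD => //; exact: is_cvg_cst.
apply: normed_cvg; rewrite /normed_series_of.
apply: nondecreasing_is_cvgn.
  by apply/nondecreasing_seqP => n; rewrite /series/= big_nat_recr//= lerDl.
exists (fine (Q x) + 2) => _ [n _ <-]; rewrite /series/= big_mkord.
apply: (@le_trans _ _ (\sum_(j < n) q j x + \sum_(j < n) 2^-1 ^+ j)); last first.
  apply: lerD; first exact: sumq_le.
  suff -> : \sum_(j < n) 2^-1 ^+ j = 2 - 2 * 2^-1 ^+ n :> R.
    by rewrite lerBlDr lerDl mulr_ge0// exprn_ge0.
  elim: n => [|n IH]; first by rewrite big_ord0 expr0; ring.
  by rewrite big_ord_recr/= IH [_ ^+ n.+1]exprS; field.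
rewrite -big_split/=; apply: ler_sum => j _; rewrite /q exprVn.
have p0 : 0 < 2 ^+ j :> R by rewrite exprn_gt0.
have := sqr_ge0 (2 ^+ j * `|dh j x| - 1); rewrite sqrrB exprMn real_normK ?num_real// expr1n.
move: p0; move: (dh j x ^+ 2) => y.
move: (`|_|) (normr_ge0 (dh j x)) => z z0 p0 H.
rewrite -(ler_pM2l p0) mulrDr divff ?gt_eqF//.
by nra.
Qed.

Let h_sqr x n : Q x \is a fin_num -> h n x ^+ 2 <= 2 * h 0%N x ^+ 2 + 4 * fine (Q x).
Proof.
move=> Qx; have := weighted_cauchy_schwarz (dh ^~ x) n; have := sumq_le n Qx.
rewrite hE /q/=; move: (\sum_(j < n) _ * _) => s1; move: (\sum_(j < n) _) => s2 s1Q s2s1.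
have := sqr_ge0 (h 0%N x - s2); rewrite sqrrB sqrrD; lra.
Qed.

(** An upper limit is measurable without any convergence assumption, and it coincides with the limit
    wherever [Q] is finite. *)
Let G x := fine (limn_esup (fun n => (h n x)%:E)).

Let mG : measurable_fun D G.
Proof.
apply: (@measurableT_comp _ _ _ _ _ _ fine); first exact: fine_measurable.
by apply: measurable_fun_limn_esup => n; apply/measurable_EFinP; exact: mpsum.
Qed.

Let hG x : Q x \is a fin_num -> h ^~ x @ \oo --> G x.
Proof.
move=> Qx; have hc := h_cvg Qx.
suff -> : G x = limn (h ^~ x) by exact: hc.
rewrite /G is_cvg_limn_esupE; first by rewrite [limn _](EFin_lim hc).
by apply/cvg_ex; exists (limn (h ^~ x))%:E; apply: cvg_EFin => //; exact: nearW.
Qed.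

Let dom_int g v : has_integral g v ->
  mu.-integrable D (fun x => (2 * h 0%N x ^+ 2 + g x)%:E + 4%:E * Q x)%E.
Proof.
move=> gv; apply: integrableD => //; last exact: integrableZl.
have h0 : has_integral (fun x => h 0%N x ^+ 2) (sig (nu 0)).
  by apply: has_integral_eq (psum_psum (leqnn _)) => // x _; rewrite expr2.
by have [] := has_integral_lin mD 2 h0 gv.
Qed.

(** Both integrals pass to the limit along [h] by dominated convergence. The coefficient of [h n] at
    [e k] is [c k] as soon as [k < nu n], and the squared norm of [h n] is [sig (nu n)]. *)
Lemma riesz_fischer : exists2 g : T -> R, measurable_fun D g &
  (forall k, has_integral (fun x => g x * e k x) (c k)) /\
  has_integral (fun x => g x ^+ 2) (limn (fun n => \sum_(k < n) c k ^+ 2)).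
Proof.
exists G => //; split.
- move=> k; have ek : has_integral (fun x => e k x ^+ 2) 1.
    by have := eo k k; rewrite eqxx; apply: has_integral_eq.
  apply: (has_integral_dct mD (f_ := fun n x => h n x * e k x)
    (v_ := fun n => if (k < nu n)%N then c k else 0) _ _ _ (dom_int ek)).
  + by move=> n; exact: psum_e.
  + exact: measurable_funM.
  + apply: filterS Q_ae => x /[apply] Qx.
    by apply: cvgM; [exact: hG|exact: cvg_cst].
  + apply: filterS Q_ae => x + n Dx => /(_ Dx) Qx.
    rewrite -(fineK Qx) -EFinM -EFinD lee_fin ler_norml.
    have := h_sqr n Qx; have := sqr_ge0 (h n x - e k x); have := sqr_ge0 (h n x + e k x).
    by have := sqr_ge0 (h n x); have := sqr_ge0 (e k x); rewrite sqrrD sqrrB; lra.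
  + apply: cvg_near_cst; exists k.+1 => // n /= kn.
    by rewrite (leq_trans kn (nu_ge n)).
- have i0 : has_integral (fun=> 0) 0 by exact: has_integral0.
- have -> : limn (fun n => \sum_(k < n) c k ^+ 2) = ell by apply: cvg_lim.
  apply: (has_integral_dct mD (f_ := fun n x => h n x ^+ 2)
    (v_ := fun n => sig (nu n)) _ _ _ (dom_int i0)).
  + by move=> n; apply: has_integral_eq (psum_psum (leqnn _)) => // x _; rewrite expr2.
  + exact: measurable_funX.
  + by apply: filterS Q_ae => x /[apply] Qx; apply: cvgM; exact: hG.
  + apply: filterS Q_ae => x + n Dx => /(_ Dx) Qx.
    rewrite -(fineK Qx) -EFinM -EFinD lee_fin addr0 ger0_norm ?sqr_ge0//.
    exact: h_sqr.
  + apply/cvgrPdist_le => eps eps0.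
    have /cvgrPdist_le/(_ _ eps0)[n _ H] := sig_cvg.
    by exists n => // m /= nm; apply: H => /=; exact: leq_trans nm (nu_ge m).
Qed.

End riesz_fischer.

(** * Measures on [-1, 1] are determined by their moments *)

Lemma bernoulli_ineq {R : realDomainType} (y : R) m :
  -1 <= y -> 1 + m%:R * y <= (1 + y) ^+ m.
Proof.
move=> y1; elim: m => [|m IH]; first by rewrite mul0r addr0 expr0.
rewrite exprS; apply: (@le_trans _ _ ((1 + y) * (1 + m%:R * y))); last first.
  by apply: ler_wpM2l => //; lra.
have : 0 <= m%:R * y ^+ 2 by rewrite mulr_ge0 ?sqr_ge0.
by rewrite -natr1; nra.
Qed.

Section step_polynomials.
Context {R : realType}.

(** Bernoulli's inequality squeezes the sequence between [1 - (2 t)^n] and [1]. *)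
Lemma step_cvg1 (t : R) : 0 <= t -> t < 2^-1 ->
  (1 - t ^+ n) ^+ (2 ^ n) @[n --> \oo] --> (1 : R).
Proof.
move=> t0 t2.
apply: (@squeeze_cvgr _ _ _ _ (fun n => 1 - (2 * t) ^+ n) (cst 1)).
- apply: nearW => n; have tn0 : 0 <= t ^+ n by rewrite exprn_ge0.
  have tn1 : t ^+ n <= 1 by rewrite exprn_ile1//; lra.
  apply/andP; split; last by rewrite exprn_ile1//; lra.
  have := @bernoulli_ineq R (- t ^+ n) (2 ^ n).
  by rewrite natrX mulrN -exprMn; apply; lra.
- rewrite -[X in _ --> X]subr0; apply: cvgB; first exact: cvg_cst.
  by apply: cvg_expr; rewrite ger0_norm; lra.
- exact: cvg_cst.
Qed.

(** Bernoulli's inequality gives [(2 t)^n <= (1 + t^n)^(2^n)], and the product of this power with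
    the given one is at most [1]; hence the upper bound [(2 t)^(-n)]. *)
Lemma step_cvg0 (t : R) : 2^-1 < t -> t <= 1 ->
  (1 - t ^+ n) ^+ (2 ^ n) @[n --> \oo] --> (0 : R).
Proof.
move=> t2 t1.
apply: (@squeeze_cvgr _ _ _ _ (cst 0) (fun n => (2 * t)^-1 ^+ n)).
- apply: nearW => n; have tn0 : 0 <= t ^+ n by rewrite exprn_ge0//; lra.
  have tn1 : t ^+ n <= 1 by rewrite exprn_ile1//; lra.
  have b0 : 0 <= (1 - t ^+ n) ^+ (2 ^ n) by rewrite exprn_ge0//; lra.
  rewrite b0/= exprVn.
  have p0 : 0 < (2 * t) ^+ n by rewrite exprn_gt0//; lra.
  rewrite -(ler_pM2r p0) mulVf ?gt_eqF//.
  have := @bernoulli_ineq R (t ^+ n) (2 ^ n); rewrite natrX -exprMn => B.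
  apply: (@le_trans _ _ ((1 - t ^+ n) ^+ (2 ^ n) * (1 + t ^+ n) ^+ (2 ^ n))).
    by apply: ler_wpM2l => //; apply: le_trans (B _); lra.
  rewrite -exprMn exprn_ile1//; nra.
- exact: cvg_cst.
- by apply: cvg_expr; rewrite ger0_norm ?invr_ge0 ?invf_lt1; lra.
Qed.

(* The argument [t = 1/2 + (x - a) / 4] of [(1 - t^n)^(2^n)] stays in [0, 1] for
   [x, a] in [-1, 1], and crosses the threshold [1/2] at [x = a]. *)
Definition step_poly (a : R) n : {poly R} :=
  (1 - ((2^-1 - a / 4)%:P + 4^-1 *: 'X) ^+ n) ^+ (2 ^ n).

Lemma step_polyE a n x :
  (step_poly a n).[x] = (1 - (2^-1 + (x - a) / 4) ^+ n) ^+ (2 ^ n).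
Proof. by rewrite /step_poly !hornerE; do 4 f_equal; ring. Qed.

End step_polynomials.

Section moments.
Context {R : realType}.
Notation mu := (@lebesgue_measure R).
Let D : set R := `]-1, 1[.
Let mD : measurable D. Proof. exact: measurable_itv. Qed.
Variable f : R -> R.
Hypothesis fp : forall p : {poly R}, has_integral mu D (fun x => f x * p.[x]) 0.

Let fi : mu.-integrable D (EFin \o f).
Proof.
have : has_integral mu D f 0 by apply: has_integral_eq (fp 1) => // x _; rewrite hornerE mulr1.
by case.
Qed.

Let mf : measurable_fun D f.
Proof. by move/integrableP : fi => [/measurable_EFinP]. Qed.

Let ae_neq (a : R) : {ae mu, forall x : R, x != a}.
Proof.
exists [set a]; split; [exact: measurable_set1|exact: lebesgue_measure_set1|].
by move=> x /= /negP; rewrite negbK => /eqP.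
Qed.

Let step_int (a : R) : -1 < a -> a < 1 -> has_integral mu D (fun x => f x * (x <= a)%R%:R) 0.
Proof.
move=> a1 a2; apply: (@has_integral_dct _ _ _ mu D mD (fun n x => f x * (step_poly a n).[x])
  (fun=> 0) _ 0 (fun x => `|f x|%:E)).
- by [].
- apply: measurable_funM => //.
  rewrite (_ : (fun x => _) = (fun x => \1_(`]-oo, a]) x)); last first.
    by apply/funext => x; rewrite indicE; congr (_%:R); rewrite mem_setE in_itv.
  exact: measurable_indic.
(* At [x = a], where [t = 1/2], neither limit lemma applies; this single point is discarded. *)
- apply: filterS (ae_neq a); first exact: (ae_filter_ringOfSetsType mu).
  move=> x xa; rewrite /D/= in_itv/= => /andP[x1 x2].
  apply: cvgM; first exact: cvg_cst.
  under eq_fun do rewrite step_polyE.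
  case: (ltgtP x a) xa => // xa _ /=.
  + by apply: step_cvg1; lra.
  + by apply: step_cvg0; lra.
- exact: integrable_norm.
- apply: aeW => x n; rewrite /D/= in_itv/= => /andP[x1 x2].
  rewrite lee_fin step_polyE normrM ler_piMr//.
  have tn0 : 0 <= (2^-1 + (x - a) / 4) ^+ n by rewrite exprn_ge0//; lra.
  have tn1 : (2^-1 + (x - a) / 4) ^+ n <= 1 by rewrite exprn_ile1//; lra.
  by rewrite normrX exprn_ile1// ger0_norm; lra.
- exact: cvg_cst.
Qed.

Let step_intT (a : R) : (\int[mu]_(x in D) (f x * (x <= a)%R%:R)%:E = 0)%E.
Proof.
have [a1|a1] := leP a (-1).
  rewrite integral0_eq// => x; rewrite /D/= in_itv/= => /andP[x1 x2].
  by rewrite leNgt (le_lt_trans a1 x1)/= mulr0.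
have [a2|a2] := leP 1 a; last by have [] := step_int a1 a2.
have [_ H] := fp 1; rewrite -[RHS]/(0%:E) -H; apply: eq_integral => x;
  rewrite inE/D/= in_itv/= => /andP[x1 x2].
by rewrite (ltW (lt_le_trans x2 a2)) !hornerE ?mulr1.
Qed.

(** Extended by zero, [f] has vanishing integral over every half-line []-oo, x]]. So its primitive
    is zero, and almost everywhere the function is the derivative of its primitive. *)
Lemma moments_ae0 : {ae mu, forall x, D x -> f x = 0}.
Proof.
pose h := f \_ D.
have hi : mu.-integrable setT (EFin \o h).
  by move: fi; rewrite integrable_mkcond//= (restrict_EFin f).
have hiS A : measurable A -> mu.-integrable A (EFin \o h).
  by move=> mA; apply: integrableS hi.
have hF x : (\int[mu]_(t in `]-oo, x]) h t)%R = 0.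
  rewrite /Rintegral (_ : integral _ _ _ = 0%E)//.
  rewrite -[RHS](step_intT x) [RHS]integral_mkcond [LHS]integral_mkcond.
  apply: eq_integral => t _; rewrite !patchE mem_setE in_itv/= /h patchE.
  by case: ifPn => tx; case: ifPn => //= _; rewrite ?mulr1 ?mulr0.
pose F (x : R) := (\int[mu]_(t in `]-oo, x]) h t)%R.
have : {ae mu, forall x, derivable F x 1 /\ derive1 F x = h x}.
  apply: FTC1Ny; first by move=> y; apply: hiS; exact: measurable_itv.
  split; [|exact: openT|].
  - by move/integrableP : hi => [/measurable_EFinP].
  - move=> K _ cK; have /integrableP[_] := hiS K (compact_measurable cK).
    exact.
apply: filterS; first exact: (ae_filter_ringOfSetsType mu).
move=> x [_ +] Dx.
rewrite (_ : F = cst 0); last by apply/funext => y; exact: hF.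
by rewrite derive1_cst /h patchE mem_set.
Qed.

End moments.

(** * Chebyshev polynomials and the Bernstein-Szego weights *)

Lemma two_step_ind (P : nat -> Prop) : P 0%N -> P 1%N ->
  (forall n, P n -> P n.+1 -> P n.+2) -> forall n, P n.
Proof. by move=> P0 P1 PS n; elim: n {-2}n (leqnn n) => [[]//|n IH [|[|m]]// mn]; apply: PS;
  apply: IH; lia. Qed.

Section chebyshev.
Context {R : realType}.
Implicit Types (a x t : R).

(* [cheb 0] are the Chebyshev polynomials of the second kind [U_k], and
   [cheb a] is [U_k - a U_(k-1)]. *)
Fixpoint cheb a x (k : nat) : R :=
  if k is k1.+1 then
    (if k1 is k2.+1 then 2 * x * cheb a x k1 - cheb a x k2 else 2 * x - a)
  else 1.

Lemma chebSS a x k : cheb a x k.+2 = 2 * x * cheb a x k.+1 - cheb a x k.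
Proof. by []. Qed.

Lemma chebE a x k : cheb a x k.+1 = cheb 0 x k.+1 - a * cheb 0 x k.
Proof.
elim/two_step_ind: k => [||k IH1 IH2]; [by rewrite /=; ring|by rewrite /=; ring|].
by rewrite chebSS IH1 IH2 !(chebSS 0); ring.
Qed.

(** Both sides obey the same three-term recurrence in [k]. The identity trades an integral against
    [w_c] for integrals against [bs_weight a]. *)
Lemma cheb_den a x k :
  (1 - 2 * a * x + a ^+ 2) * cheb 0 x k = cheb a x k - a * cheb a x k.+1.
Proof.
elim/two_step_ind: k => [||k IH1 IH2]; [by rewrite /=; ring|by rewrite /=; ring|].
have -> : (1 - 2 * a * x + a ^+ 2) * cheb 0 x k.+2 =
    2 * x * ((1 - 2 * a * x + a ^+ 2) * cheb 0 x k.+1) -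
    (1 - 2 * a * x + a ^+ 2) * cheb 0 x k by rewrite chebSS; ring.
by rewrite IH1 IH2 !chebSS; ring.
Qed.

(** The truncated generating series of the [U_k], with its remainder; it telescopes by
    [cheb_den]. *)
Lemma cheb_geo a x n :
  (1 - 2 * a * x + a ^+ 2) * \sum_(k < n) a ^+ k * cheb 0 x k = 1 - a ^+ n * cheb a x n.
Proof.
elim: n => [|n IH]; first by rewrite big_ord0 expr0/=; ring.
by rewrite big_ord_recr [LHS]/= mulrDr IH mulrCA cheb_den exprS; ring.
Qed.

Lemma cheb_cos t k : cheb 0 (cos t) k * sin t = sin (k.+1%:R * t).
Proof.
elim/two_step_ind: k => [||k IH1 IH2]; first by rewrite /= !mul1r.
  by rewrite /= subr0 [in RHS]mulr_natl sin_mulr2n mulr2n; ring.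
rewrite chebSS mulrBl IH1 -[2 * cos t * _ * sin t]mulrA IH2.
have -> : k.+3%:R * t = k.+2%:R * t + t by rewrite -[k.+3%:R]natr1; ring.
have -> : k.+1%:R * t = k.+2%:R * t - t by rewrite -[k.+2%:R]natr1; ring.
by rewrite sinB sinD; ring.
Qed.

Lemma cheb_bound0 x k : -1 <= x <= 1 -> `|cheb 0 x k * Num.sqrt (1 - x ^+ 2)| <= 1.
Proof.
move=> x1; rewrite -sin_acos// -[in cheb _ _ _](@acosK _ x) ?in_itv//.
by rewrite cheb_cos sin_max.
Qed.

Lemma cheb_bound a x k : 0 <= a <= 1 -> -1 <= x <= 1 ->
  `|cheb a x k * Num.sqrt (1 - x ^+ 2)| <= 2.
Proof.
move=> /andP[a0 a1] x1; case: k => [|k].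
  by have := cheb_bound0 0 x1; rewrite /=; lra.
rewrite chebE mulrBl -[a * _ * _]mulrA (le_trans (ler_normB _ _))// [X in _ + X]normrM
  (ger0_norm a0).
have := cheb_bound0 k.+1 x1; have := cheb_bound0 k x1.
move: (`|_|) (normr_ge0 (cheb 0 x k * Num.sqrt (1 - x ^+ 2))) => y y0.
by move: (`|_|) => z; nra.
Qed.

Lemma continuous_cheb a k : continuous (fun x => cheb a x k).
Proof.
elim/two_step_ind: k => [||k IH1 IH2] x /=.
- exact: cvg_cst.
- by apply: cvgB; [apply: cvgM; [exact: cvg_cst|exact: cvg_id]|exact: cvg_cst].
- apply: cvgB; last exact: IH1.
  by apply: cvgM; [apply: cvgM; [exact: cvg_cst|exact: cvg_id]|exact: IH2].
Qed.

Lemma continuous_w_c : continuous (@w_c R).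
Proof.
move=> x; apply: cvgM; first exact: cvg_cst.
apply: (@continuous_cvg _ _ _ _ _ _ (@Num.sqrt R)); first exact: sqrt_continuous.
by apply: cvgB; [exact: cvg_cst|apply: cvgM; exact: cvg_id].
Qed.

Notation mu := (@lebesgue_measure R).
Let D : set R := `]-1, 1[.
Let mD : measurable D. Proof. exact: measurable_itv. Qed.

(** A primitive of [cos (k t)]; [k = 0] is separate because division by [0] would give the zero
    function. *)
Let psin (k : nat) t : R := if k == 0%N then t else sin (k%:R * t) / k%:R.

Let is_derive_psin k t : is_derive t 1 (psin k) (cos (k%:R * t)).
Proof.
rewrite /psin; case: eqP => [->|/eqP k0].
  by rewrite mul0r cos0; exact: is_derive_id.
have k0' : k%:R != 0 :> R by rewrite pnatr_eq0.
apply: is_derive_eq.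
  by rewrite /GRing.scale/= mulr1; field.
Qed.

(** Under [x = cos t] the integrand becomes [pi^-1 (cos (k t) - cos ((k + 2) t))], whose integral
    over [[0, pi]] is nonzero for [k = 0] only. *)
Lemma integral_cheb_w_c k : has_integral mu D (fun x => cheb 0 x k * w_c x) (k == 0%N)%:R.
Proof.
have pi0 := @pi_gt0 R.
pose G x := cheb 0 x k * w_c x.
have cG : continuous G.
  by move=> x; apply: cvgM; [exact: continuous_cheb|exact: continuous_w_c].
have iG : mu.-integrable `[-1, 1] (EFin \o G).
  apply: continuous_compact_integrable; first exact: segment_compact.
  exact: continuous_subspaceT.
split; first by apply: integrableS iG => //; exact: subset_itv_oo_cc.
have -> : (\int[mu]_(x in D) (G x)%:E = \int[mu]_(x in `[(-1)%R, 1%R]) (G x)%:E)%E.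
  rewrite [RHS]integral_itv_bndoo//; apply/measurable_EFinP.
  apply: (measurable_funS (measurable_itv `[-1, 1])); first exact: subset_itv_oo_cc.
  by move/integrableP : iG => [/measurable_EFinP].
have dcos : derive1 (@cos R) = (fun t => - sin t).
  by apply/funext => t; rewrite derive1E derive_val.
have csin : continuous (fun t : R => - sin t).
  by move=> t; apply: cvgN; exact: continuous_sin.
have LR (f : R -> R) a b : (forall t, derivable f t 1) -> derivable_oo_LRcontinuous f a b.
  move=> df; have cf : continuous f.
    by move=> t; apply: differentiable_continuous; exact/derivable1_diffP.
  split; [by move=> t _|apply: cvg_at_right_filter; exact: cf|apply: cvg_at_left_filter; exact: cf].
rewrite -[in LHS]cospi -[X in `[_, X]](@cos0 R).
rewrite (@integration_by_substitution_decreasing R (@cos R) G 0 pi (ltW pi0)); first last.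
- exact: continuous_subspaceT.
- by apply: LR => t; exact: derivable_cos.
- by rewrite dcos; apply/cvg_ex; exists (- sin pi); apply: cvg_at_left_filter; exact: csin.
- by rewrite dcos; apply/cvg_ex; exists (- sin 0); apply: cvg_at_right_filter; exact: csin.
- by rewrite dcos => t _; exact: csin.
- by move=> x y x0 y0; rewrite ltr_cos.
pose F t : R := pi^-1 * (psin k t - psin k.+2 t).
pose f t : R := pi^-1 * (cos (k%:R * t) - cos (k.+2%:R * t)).
rewrite (_ : integral _ _ _ = \int[mu]_(t in `[0%R, pi]) (f t)%:E)%E; last first.
  apply: eq_integral => t; rewrite inE/= in_itv/= => t0pi; congr EFin.
  have s0 : 0 <= sin t by rewrite sin_ge0_pi.
  rewrite /G /w_c !fctE dcos opprK -sin2cos2 sqrtr_sqr ger0_norm//.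
  have -> : cheb 0 (cos t) k * (2 / pi * sin t) * sin t =
    pi^-1 * (2 * (cheb 0 (cos t) k * sin t) * sin t) by ring.
  rewrite cheb_cos /f; congr (_ * _).
  have -> : k%:R * t = k.+1%:R * t - t by rewrite -[k.+1%:R]natr1; ring.
  have -> : k.+2%:R * t = k.+1%:R * t + t by rewrite -[k.+2%:R]natr1; ring.
  by rewrite cosB cosD; ring.
have dF t : is_derive t 1 F (f t).
  exact: (is_deriveZ (pi^-1 : R) (is_deriveB (is_derive_psin k t) (is_derive_psin k.+2 t))).
rewrite (@continuous_FTC2 _ f F 0 pi pi0).
- rewrite -EFinB /F /psin; congr EFin.
  have sk n : sin (n%:R * pi) = 0 :> R.
    elim: n => [|n IH]; first by rewrite mul0r sin0.
    by rewrite -natr1 mulrDl mul1r sinDpi IH oppr0.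
  case: k {cG iG G F f dF} => [|k] /=; rewrite !sk !mulr0 sin0; last by ring.
  by rewrite mul0r !subr0 mulr0 subr0 mulVf // lt0r_neq0.
- apply: continuous_subspaceT => t; rewrite /f.
  apply: cvgM; first exact: cvg_cst.
  have ck n : cos (n%:R * x) @[x --> t] --> cos (n%:R * t).
    apply: (@continuous_cvg _ _ _ _ _ _ (@cos R)); first exact: continuous_cos.
    by apply: cvgM; [exact: cvg_cst|exact: cvg_id].
  by apply: cvgB; exact: ck.
- by apply: LR => t; have [] := dF t.
- by move=> t _; rewrite derive1E; have [_ ->] := dF t.
Qed.

End chebyshev.

(** * Orthonormality for the Bernstein-Szego weights *)

Section bernstein_szego.
Context {R : realType}.
Implicit Types (a x t : R).
Notation mu := (@lebesgue_measure R).
Let D : set R := `]-1, 1[.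
Let mD : (R.-ocitv.-measurable).-sigma.-measurable D. Proof. exact: measurable_itv. Qed.

Definition bs_weight a x : R := w_c x / (1 - 2 * a * x + a ^+ 2).

(** The denominator is [(1 - a)^2 + 2 a (1 - x)]. For [a = 1], which occurs when [N = 1], it
    vanishes at [x = 1]; hence the open interval [D]. *)
Lemma bs_weight_den_gt0 a x : 0 <= a <= 1 -> D x -> 0 < 1 - 2 * a * x + a ^+ 2.
Proof.
rewrite /D/= in_itv/= => /andP[a0 a1] /andP[x1 x2].
have -> : 1 - 2 * a * x + a ^+ 2 = (1 - a) ^+ 2 + 2 * a * (1 - x) by ring.
have [->|an0] := eqVneq a 0; first by rewrite mulr0 mul0r addr0 subr0 expr1n.
have a_gt0 : 0 < a by rewrite lt_neqAle eq_sym an0.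
by rewrite ltr_wpDl ?sqr_ge0// !mulr_gt0// subr_gt0.
Qed.

Lemma w_c_gt0 x : D x -> 0 < w_c x.
Proof.
rewrite /D/= in_itv/= => /andP[x1 x2].
rewrite /w_c mulr_gt0 ?divr_gt0 ?pi_gt0// sqrtr_gt0; nra.
Qed.

Lemma bs_weight_gt0 a x : 0 <= a <= 1 -> D x -> 0 < bs_weight a x.
Proof. by move=> a01 Dx; rewrite divr_gt0 ?w_c_gt0 ?bs_weight_den_gt0. Qed.

Let continuous_den a : continuous (fun x => 1 - 2 * a * x + a ^+ 2).
Proof.
move=> x; apply: cvgD; last exact: cvg_cst.
by apply: cvgB; [exact: cvg_cst|apply: cvgM; [exact: cvg_cst|exact: cvg_id]].
Qed.

Lemma continuous_bs_weight a x : 0 <= a <= 1 -> D x -> {for x, continuous (bs_weight a)}.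
Proof.
move=> a01 Dx; apply: cvgM; first exact: continuous_w_c.
by apply: cvgV; [rewrite lt0r_neq0// bs_weight_den_gt0|exact: continuous_den].
Qed.

Lemma measurable_bs_weight a : 0 <= a <= 1 -> measurable_fun D (bs_weight a).
Proof.
move=> a01; apply: subspace_continuous_measurable_fun => //.
by apply: continuous_in_subspaceT => x; rewrite inE => Dx; exact: continuous_bs_weight.
Qed.

Lemma measurable_cheb a k : measurable_fun D (fun x => cheb a x k).
Proof.
apply: (measurable_funS measurableT) => //.
exact: continuous_measurable_fun (@continuous_cheb R a k).
Qed.

Let bound_w_c a x k : 0 <= a <= 1 -> D x -> `|cheb a x k * w_c x| <= 2 * (2 / pi).
Proof.
rewrite /D/= in_itv/= => a01 /andP[x1 x2].
have p0 : 0 <= 2 / pi :> R by rewrite divr_ge0// pi_ge0.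
rewrite /w_c mulrCA normrM (ger0_norm p0) mulrC ler_wpM2r//.
by apply: cheb_bound => //; rewrite !ltW.
Qed.

(** Termwise integration of the generating series of [cheb_geo] against [w_c]: only [k = 0]
    contributes. *)
Let integral_bs_weight_lt1 a : 0 <= a -> a < 1 -> has_integral mu D (bs_weight a) 1.
Proof.
move=> a0 a1; have a01 : 0 <= a <= 1 by rewrite a0 ltW.
have den_ge x : D x -> (1 - a) ^+ 2 <= 1 - 2 * a * x + a ^+ 2.
  by rewrite /D/= in_itv/= => /andP[x1 x2]; nra.
have b0 : 0 < (1 - a) ^+ 2 by rewrite exprn_gt0// subr_gt0.
pose g n x := \sum_(k < n) a ^+ k * (cheb 0 x k * w_c x).
have gE n x : D x -> g n x = bs_weight a x - a ^+ n * (cheb a x n * w_c x / (1 - 2 * a * x +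
  a ^+ 2)).
  move=> Dx; have d0 := lt0r_neq0 (bs_weight_den_gt0 a01 Dx).
  have -> : g n x = (\sum_(k < n) a ^+ k * cheb 0 x k) * w_c x.
    by rewrite mulr_suml; apply: eq_bigr => k _; rewrite mulrA.
  have -> : \sum_(k < n) a ^+ k * cheb 0 x k =
      (1 - a ^+ n * cheb a x n) / (1 - 2 * a * x + a ^+ 2).
    by rewrite -cheb_geo mulrAC divff// mul1r.
  by rewrite /bs_weight; field.
(* The remainder is [a^n] times a quantity bounded uniformly in [n] and [x], since the denominator
   is at least [(1 - a)^2]. *)
have q x n : D x -> `|cheb a x n * w_c x / (1 - 2 * a * x + a ^+ 2)| <= 2 * (2 / pi) / (1 - a) ^+ 2.
  move=> Dx; rewrite normrM normfV (gtr0_norm (bs_weight_den_gt0 a01 Dx)).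
  apply: ler_pM => //; first by rewrite invr_ge0 ltW// bs_weight_den_gt0.
    exact: bound_w_c.
  by rewrite lef_pV2 ?posrE ?bs_weight_den_gt0// den_ge.
set C := 2 * (2 / pi) / (1 - a) ^+ 2 in q.
apply: (@has_integral_dct _ _ _ mu D mD g (fun n => \sum_(k < n) a ^+ k * (k == 0%N :> nat)%:R)
   _ 1 (fun=> (2 * C)%:E)).
- move=> n; apply: (@has_integral_sum _ _ _ mu D mD n (fun k x => a ^+ k * (cheb 0 x k * w_c x))
    (fun k => a ^+ k * (k == 0%N)%:R)) => k _.
  by apply: has_integralZ => //; exact: integral_cheb_w_c.
- exact: measurable_bs_weight.
- apply: aeW => x Dx.
  rewrite (_ : g ^~ x = fun n => bs_weight a x - a ^+ n * (cheb a x n * w_c x / (1 - 2 * a * x +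
    a ^+ 2))); last first.
    by apply/funext => n; rewrite gE.
  rewrite -[X in _ --> X]subr0; apply: cvgB; first exact: cvg_cst.
  apply/cvgr0Pnorm_le => e e0.
  have /cvgr0Pnorm_le/(_ (e / (C + 1))) : a ^+ n @[n --> \oo] --> (0 : R).
    by apply: cvg_expr; rewrite ger0_norm.
  have C0 : 0 <= C by apply: le_trans (q x 0%N Dx).
  have C1 : 0 < C + 1 by lra.
  rewrite divr_gt0// => /(_ isT); apply: filterS => n an.
  rewrite normrM -[e](@divfK _ (C + 1)) ?gt_eqF//; apply: ler_pM => //.
  by apply: le_trans (q x n Dx) _; lra.
- have iC : mu.-integrable `[-1, 1] (EFin \o (fun=> 2 * C)).
    apply: continuous_compact_integrable; first exact: segment_compact.
    by apply: continuous_subspaceT => x; exact: cvg_cst.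
  by apply: integrableS iC => //; exact: subset_itv_oo_cc.
- apply: aeW => x n Dx; rewrite lee_fin gE// (le_trans (ler_normB _ _))//.
  have := q x n Dx; have := q x 0%N Dx; rewrite /= mul1r -/(bs_weight a x) => q0 qn.
  have an1 : `|a ^+ n| <= 1 by rewrite ger0_norm ?exprn_ge0// exprn_ile1// ltW.
  rewrite [X in _ + X]normrM; set z := `|cheb a x n * _ / _| in qn *.
  apply: (@le_trans _ _ (C + z)); last by move: q0 qn; rewrite -/z; lra.
  by apply: lerD => //; apply: ler_piMl => //; exact: normr_ge0.
- apply: cvg_near_cst; exists 1%N => // n /= n0.
  case: n n0 => // n _; rewrite big_ord_recl/= expr0 mulr1 big1 ?addr0// => k _.
  by rewrite mulr0.
Qed.

(* The limit [a -> 1] of the previous lemma; Fatou first gives the integrability of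
   the dominating function [2 * bs_weight 1]. *)
Let integral_bs_weight1 : has_integral mu D (bs_weight 1) 1.
Proof.
(* The shift by [2] puts [a_ n] in [[1/2, 1[], where [1 - x <= 1 - 2 a x + a^2]; this yields the
   domination of [bs_weight (a_ n)] by [2 * bs_weight 1]. *)
pose a_ n : R := 1 - (n.+2%:R)^-1.
have i0 n : 0 < n.+2%:R^-1 :> R by rewrite invr_gt0.
have i2 n : n.+2%:R^-1 <= 2^-1 :> R by rewrite lef_pV2 ?posrE// ler_nat.
have a_1 n : has_integral mu D (bs_weight (a_ n)) 1.
  by apply: integral_bs_weight_lt1; rewrite /a_; move: (_^-1) (i0 n) (i2 n) => y ? ?; lra.
have a01 n : 0 <= a_ n <= 1.
  by apply/andP; split; rewrite /a_; move: (_^-1) (i0 n) (i2 n) => y ? ?; lra.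
have o01 : 0 <= (1 : R) <= 1 by rewrite ler01 lexx.
have acvg : a_ @ \oo --> (1 : R).
  rewrite -[X in _ --> X]subr0; apply: cvgB; first exact: cvg_cst.
  have := @cvg_harmonic R; rewrite -(cvg_shiftn 1).
  by apply: cvg_trans; apply: near_eq_cvg; apply: nearW => n; rewrite /harmonic/= addn1.
have wcvg x : D x -> bs_weight (a_ n) x @[n --> \oo] --> bs_weight 1 x.
  move=> Dx; apply: cvgM; first exact: cvg_cst.
  apply: cvgV; first by rewrite lt0r_neq0// bs_weight_den_gt0.
  apply: cvgD; last by apply: cvgM; exact: acvg.
  apply: cvgB; first exact: cvg_cst.
  by apply: cvgM; [apply: cvgM; [exact: cvg_cst|exact: acvg]|exact: cvg_cst].
have w1i : mu.-integrable D (EFin \o bs_weight 1).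
  apply/integrableP; split; first by apply/measurable_EFinP; exact: measurable_bs_weight.
  apply: (@le_lt_trans _ _ 1%E); last exact: ltry.
  have -> : (\int[mu]_(x in D) `|(EFin \o bs_weight 1) x| =
      \int[mu]_(x in D) limn_einf (fun n => (bs_weight (a_ n) x)%:E))%E.
    apply: eq_integral => x; rewrite inE => Dx /=.
    have H : EFin \o (fun n => bs_weight (a_ n) x) @ \oo --> (bs_weight 1 x)%:E.
      by apply: cvg_EFin; [exact: nearW|exact: wcvg].
    rewrite is_cvg_limn_einfE; last by apply/cvg_ex; exists (bs_weight 1 x)%:E.
    by rewrite (cvg_lim _ H)// ger0_norm// ltW// bs_weight_gt0.
  apply: le_trans (@fatou _ _ _ mu D mD (fun n x => (bs_weight (a_ n) x)%:E) _ _) _.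
  - by move=> n; apply/measurable_EFinP; exact: measurable_bs_weight.
  - by move=> n x Dx; rewrite lee_fin ltW// bs_weight_gt0.
  under eq_fun do rewrite (a_1 _).2.
  have c1 : (fun=> 1%:E) @ \oo --> (1%:E : \bar R) by exact: cvg_cst.
  by rewrite is_cvg_limn_einfE; [rewrite (cvg_lim _ c1)|apply/cvg_ex; exists 1%:E].
apply: (@has_integral_dct _ _ _ mu D mD (fun n => bs_weight (a_ n)) (fun=> 1) _ 1
  (fun x => 2%:E * (EFin \o bs_weight 1) x)%E) => //.
- exact: measurable_bs_weight.
- exact: aeW.
- exact: integrableZl.
- apply: aeW => x n Dx; rewrite lee_fin ger0_norm; last by rewrite ltW// bs_weight_gt0.
  rewrite /bs_weight mulrCA ler_wpM2l//; first by rewrite ltW// w_c_gt0.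
  rewrite -[X in X / _]mulr1 -ler_pdivrMl// -invfM lef_pV2 ?posrE ?mulr_gt0 ?bs_weight_den_gt0//.
  move: Dx; rewrite /D/= in_itv/= => /andP[x1 x2].
  by rewrite /a_; move: (n.+2%:R^-1) (i0 n) (i2 n) => y ? ?; nra.
- exact: cvg_cst.
Qed.

(** By [cheb_den], [a] times the integral at [k + 1] is the integral at [k] minus that of
    [cheb 0 x k * w_c x]. For [k = 0] both are [1], for [k > 0] both are [0]. Dividing by [a] sets
    the case [a = 0] apart. *)
Lemma integral_cheb_bs_weight a k : 0 <= a <= 1 ->
  has_integral mu D (fun x => cheb a x k * bs_weight a x) (k == 0%N)%:R.
Proof.
move=> a01; have [->|an0] := eqVneq a 0.
  apply: has_integral_eq (integral_cheb_w_c k) => // x _.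
  by rewrite /bs_weight mulr0 mul0r subr0 expr0n/= addr0 divr1.
elim: k => [|k IH].
  apply: (@has_integral_eq _ _ _ mu D mD (bs_weight a)); first by move=> x _; rewrite /= mul1r.
  move: a01 => /andP[a0]; rewrite le_eqVlt => /predU1P[->|]; first exact: integral_bs_weight1.
  exact: integral_bs_weight_lt1.
have Uk : has_integral mu D (fun x => cheb 0 x k * w_c x) (k == 0%N)%:R := integral_cheb_w_c k.
have := has_integralZ mD a^-1 (has_integral_lin mD (-1) Uk IH).
rewrite (_ : a^-1 * _ = (k.+1 == 0%N)%:R); last by rewrite /=; ring.
apply: has_integral_eq => // x Dx; rewrite /bs_weight.
have d0 := lt0r_neq0 (bs_weight_den_gt0 a01 Dx).
have -> : cheb a x k.+1 = a^-1 * (cheb a x k - (1 - 2 * a * x + a ^+ 2) * cheb 0 x k).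
  by rewrite cheb_den; field.
by field; rewrite ?an0 ?d0.
Qed.

(** Induction on [j]: the factor [2 x] is moved from one polynomial to the other through the
    recurrence, which at index [0] reads [2 x * cheb a x 0 = cheb a x 1 + a * cheb a x 0]. *)
Lemma cheb_orthonormal a j k : 0 <= a <= 1 ->
  has_integral mu D (fun x => cheb a x j * cheb a x k * bs_weight a x) (j == k)%:R.
Proof.
move=> a01; elim/two_step_ind: j k => [k|k|j IH1 IH2 k].
- have := integral_cheb_bs_weight k a01; rewrite eq_sym.
  by apply: has_integral_eq => // x _; rewrite /= mul1r.
- case: k => [|k].
    have := integral_cheb_bs_weight 1 a01.
    by apply: has_integral_eq => // x _; rewrite [X in _ * X * _]/= mulr1.
  have := has_integral_lin mD (- a) (integral_cheb_bs_weight k.+1 a01)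
     (has_integralD mD (integral_cheb_bs_weight k a01) (integral_cheb_bs_weight k.+2 a01)).
  rewrite (_ : _ + _ = (1%N == k.+1)%:R); last by rewrite mulr0 addr0 add0r eqSS eq_sym.
  by apply: has_integral_eq => // x _; rewrite chebSS [cheb a x 1]/=; ring.
- case: k => [|k].
    have := has_integral_lin mD a (IH2 0%N) (has_integral_lin mD (-1) (IH1 0%N) (IH2 1%N)).
    rewrite (_ : _ + _ = (j.+2 == 0%N)%:R); last by rewrite /= eqSS; case: (j == 0%N) => /=; ring.
    by apply: has_integral_eq => // x _; rewrite chebSS [cheb a x 1]/= [cheb a x 0]/=; ring.
  have := has_integral_lin mD (-1) (IH1 k.+1) (has_integralD mD (IH2 k) (IH2 k.+2)).
  rewrite (_ : _ + _ = (j.+2 == k.+1)%:R); last by rewrite !eqSS; ring.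
  by apply: has_integral_eq => // x _; rewrite !chebSS; ring.
Qed.

End bernstein_szego.

(** * Expansion in the orthonormal polynomials *)

Section chebyshev_coefficients.
Context {R : realType} (a : R).
Hypothesis a01 : 0 <= a <= 1.
Notation mu := (@lebesgue_measure R).
Let D : set R := `]-1, 1[.
Let mD : (R.-ocitv.-measurable).-sigma.-measurable D. Proof. exact: measurable_itv. Qed.
Local Notation W := (bs_weight a).
Local Notation has_integral := (has_integral mu D).
Implicit Types (g h : R -> R) (c : nat -> R).

Definition has_coef g c := [/\ measurable_fun D g,
  exists v, has_integral (fun x => g x ^+ 2 * W x) v &
  forall k, has_integral (fun x => g x * cheb a x k * W x) (c k)].

Let W_gt0 x : D x -> 0 < W x. Proof. exact: bs_weight_gt0. Qed.

Let mW : measurable_fun D W. Proof. exact: measurable_bs_weight. Qed.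

(** Multiplication by the root of the weight turns weighted integrals into plain ones, the form in
    which [bessel] and [riesz_fischer] are stated. *)
Let sW x := Num.sqrt (W x).

Let sW_gt0 x : D x -> 0 < sW x. Proof. by move=> Dx; rewrite sqrtr_gt0 W_gt0. Qed.

Let sWsW x : D x -> sW x * sW x = W x.
Proof. by move=> Dx; rewrite -expr2 sqr_sqrtr// ltW// W_gt0. Qed.

Let sW_cont x : D x -> {for x, continuous sW}.
Proof.
move=> Dx; apply: (@continuous_cvg _ _ _ _ _ _ (@Num.sqrt R)); first exact: sqrt_continuous.
exact: continuous_bs_weight.
Qed.

Let msW : measurable_fun D sW.
Proof.
apply: subspace_continuous_measurable_fun => //.
by apply: continuous_in_subspaceT => x; rewrite inE => Dx; exact: sW_cont.
Qed.

Let misW : measurable_fun D (fun x => (sW x)^-1).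
Proof.
apply: subspace_continuous_measurable_fun => //.
apply: continuous_in_subspaceT => x; rewrite inE => Dx.
by apply: cvgV; [rewrite lt0r_neq0// sW_gt0|exact: sW_cont].
Qed.

Let e k x := cheb a x k * sW x.

Let me k : measurable_fun D (e k).
Proof. by apply: measurable_funM => //; exact: measurable_cheb. Qed.

Let eo j k : has_integral (fun x => e j x * e k x) (j == k)%:R.
Proof.
have := cheb_orthonormal j k a01; apply: has_integral_eq => // x Dx.
by rewrite /e -sWsW//; ring.
Qed.

Lemma has_coef_lin (b : R) g h c d : has_coef g c -> has_coef h d ->
  has_coef (fun x => b * g x + h x) (fun k => b * c k + d k).
Proof.
move=> [mg [u gu] gc] [mh [v hv] hd].
have mgh : measurable_fun D (fun x => b * g x + h x).
  by apply: measurable_funD => //; apply: measurable_funM => //; exact: measurable_cst.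
split => //.
- apply: (@has_integral_dom _ _ _ mu D mD _ (fun x =>
     (2 * b ^+ 2) * (g x ^+ 2 * W x) + 2 * (h x ^+ 2 * W x))); last first.
    by apply: (has_integral_lin mD _ gu (has_integralZ mD _ hv)).
  + move=> x Dx; have W0 := ltW (W_gt0 Dx).
    rewrite ger0_norm; last by apply: mulr_ge0 => //; exact: sqr_ge0.
    rewrite [leRHS](_ : _ = (2 * (b * g x) ^+ 2 + 2 * h x ^+ 2) * W x); last by ring.
    apply: ler_wpM2r => //; have := sqr_ge0 (b * g x - h x).
    by rewrite sqrrB sqrrD; lra.
  + by apply: measurable_funM => //; exact: measurable_funX.
- move=> k; have := has_integral_lin mD b (gc k) (hd k).
  by apply: has_integral_eq => // x _; ring.
Qed.

(** The recurrence read on coefficients: [x] acts as a Jacobi matrix whose diagonal is zero except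
    for [a / 2] at index [0]. *)
Lemma has_coef_mulX g c : has_coef g c -> has_coef (fun x => x * g x)
  (fun k => 2^-1 * (c k.+1 + (if k is k'.+1 then c k' else a * c 0%N))).
Proof.
move=> [mg [u gu] gc]; split => [||k].
- by apply: measurable_funM => //; exact: measurable_id.
- apply: (@has_integral_dom _ _ _ mu D mD _ (fun x => g x ^+ 2 * W x)) gu; last first.
  + move=> x Dx; have W0 := ltW (W_gt0 Dx).
    rewrite ger0_norm; last by apply: mulr_ge0 => //; exact: sqr_ge0.
    apply: ler_wpM2r => //; rewrite exprMn ler_piMl ?sqr_ge0//.
    by move: Dx; rewrite /D/= in_itv/= => /andP[? ?]; nra.
  + apply: measurable_funM => //; apply: measurable_funX.
    by apply: measurable_funM => //; exact: measurable_id.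
- case: k => [|k].
    have := has_integralZ mD 2^-1 (has_integralD mD (gc 1%N) (has_integralZ mD a (gc 0%N))).
    by apply: has_integral_eq => // x _; rewrite /=; field.
  have := has_integralZ mD 2^-1 (has_integralD mD (gc k.+2) (gc k)).
  by apply: has_integral_eq => // x _; rewrite chebSS; field.
Qed.

(** Completeness. By the recurrence the coefficients of [x^n g] vanish for all [n], hence so do all
    moments of [g * bs_weight a], and [moments_ae0] applies. *)
Lemma has_coef0 g : has_coef g (fun=> 0) ->
  (\int[mu]_(x in D) (g x ^+ 2 * W x)%:E = 0)%E.
Proof.
move=> [mg _ gc].
have xn n k : has_integral (fun x => g x * cheb a x k * W x * x ^+ n) 0.
  elim: n k => [|n IH] k.
    by apply: has_integral_eq (gc k) => // x _; rewrite expr0 mulr1.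
  case: k => [|k].
    have := has_integralZ mD 2^-1 (has_integralD mD (IH 1%N) (has_integralZ mD a (IH 0%N))).
    rewrite mulr0 addr0 mulr0; apply: has_integral_eq => // x _.
    by rewrite exprS /=; field.
  have := has_integralZ mD 2^-1 (has_integralD mD (IH k.+2) (IH k)).
  rewrite addr0 mulr0; apply: has_integral_eq => // x _.
  by rewrite exprS chebSS; field.
have fp (p : {poly R}) : has_integral (fun x => g x * W x * p.[x]) 0.
  apply: (@has_integral_eq _ _ _ mu D mD
    (fun x => \sum_(i < size p) p`_i * (g x * cheb a x 0 * W x * x ^+ i))).
    move=> x _; rewrite horner_coef mulr_sumr; apply: eq_bigr => i _.
    by rewrite /= mulr1; ring.
  have := @has_integral_sum _ _ _ mu D mD (size p)
    (fun i x => p`_i * (g x * cheb a x 0 * W x * x ^+ i)) (fun i => p`_i * 0).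
  rewrite big1; last by move=> i _; rewrite mulr0.
  by apply => i _; exact: has_integralZ.
have ae0 := moments_ae0 fp.
rewrite (_ : 0%E = \int[mu]_(x in D) 0%E)%E; last by rewrite integral0.
apply: ae_eq_integral => //.
- by apply/measurable_EFinP; apply: measurable_funM => //; exact: measurable_funX.
- apply: filterS ae0; first exact: (ae_filter_ringOfSetsType mu).
  move=> x /[swap] Dx /(_ Dx) gW0.
  by rewrite expr2 -mulrA gW0 mulr0.
Qed.

Lemma has_coef_eq g h c : has_coef g c -> has_coef h c ->
  (\int[mu]_(x in D) ((g x - h x) ^+ 2 * W x)%:E = 0)%E.
Proof.
move=> gc hc; have := has_coef_lin (-1) hc gc.
have -> : (fun k => -1 * c k + c k) = fun=> 0 by apply/funext => k; ring.
by move=> /has_coef0 <-; apply: eq_integral => x _; congr EFin; ring.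
Qed.

Lemma has_coef_bessel g c v : has_coef g c -> has_integral (fun x => g x ^+ 2 * W x) v ->
  (\esum_(k in [set: nat]) (c k ^+ 2)%:E <= v%:E)%E.
Proof.
move=> [mg _ gc] gv.
rewrite -nneseries_esumT; last by move=> k; rewrite lee_fin sqr_ge0.
apply: lime_le; first by apply: is_cvg_nneseries => k _ _; rewrite lee_fin sqr_ge0.
apply: nearW => n; rewrite sumEFin lee_fin big_mkord.
apply: (@bessel _ _ _ mu D mD e eo c (fun x => g x * sW x)).
- by apply: has_integral_eq gv => // x Dx; rewrite -sWsW//; ring.
- by move=> k; apply: has_integral_eq (gc k) => // x Dx; rewrite /e -sWsW//; ring.
Qed.

Lemma has_coef_intro g : measurable_fun D g ->
  (\int[mu]_(x in D) (g x ^+ 2 * W x)%:E < +oo)%E -> exists c, has_coef g c.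
Proof.
move=> mg goo.
have [v gv] : exists v, has_integral (fun x => g x ^+ 2 * W x) v.
  apply: (has_integral_ge0_fin mD) => //; first by apply: measurable_funM => //;
    exact: measurable_funX.
  by move=> x Dx; apply: mulr_ge0; [exact: sqr_ge0|rewrite ltW// W_gt0].
have : forall k, exists s, has_integral (fun x => g x * cheb a x k * W x) s.
  move=> k; have [||||s gs] := @has_integral_mulL2 _ _ _ mu D mD (fun x => g x * sW x) (e k) v 1.
  - exact: measurable_funM.
  - exact: me.
  - by apply: has_integral_eq gv => // x Dx; rewrite -sWsW//; ring.
  - by have := eo k k; rewrite eqxx; apply: has_integral_eq.
  - by exists s; apply: has_integral_eq gs => // x Dx; rewrite /e -sWsW//; ring.
by move=> /choice[c gc]; exists c; split => //; exists v.
Qed.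

Lemma has_coef_exists c : (\esum_(k in [set: nat]) (c k ^+ 2)%:E < +oo)%E ->
  exists2 g, has_coef g c & (\int[mu]_(x in D) (g x ^+ 2 * W x)%:E =
    \esum_(k in [set: nat]) (c k ^+ 2)%:E)%E.
Proof.
have c0 k : (0 <= (c k ^+ 2)%:E)%E by rewrite lee_fin sqr_ge0.
rewrite -nneseries_esumT// => coo.
have S0 : (0 <= \sum_(k <oo) (c k ^+ 2)%:E)%E by exact: nneseries_ge0.
have Sfin : (\sum_(k <oo) (c k ^+ 2)%:E)%E \is a fin_num by rewrite ge0_fin_numE.
have cB n : \sum_(k < n) c k ^+ 2 <= fine (\sum_(k <oo) (c k ^+ 2)%:E)%E.
  rewrite -lee_fin fineK// -sumEFin -(big_mkord xpredT (fun k => (c k ^+ 2)%:E)).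
  exact: nneseries_lim_ge.
have [G mG [Gc G2]] := riesz_fischer mD me eo cB.
have gG x : D x -> G x / sW x * sW x = G x.
  by move=> Dx; rewrite divfK// lt0r_neq0// sW_gt0.
have iG : has_integral (fun x => (G x / sW x) ^+ 2 * W x) (limn (fun n => \sum_(k < n) c k ^+ 2)).
  apply: has_integral_eq G2 => // x Dx; rewrite -sWsW// -[in LHS]gG//; ring.
exists (fun x => G x / sW x).
- split; [exact: measurable_funM|by eexists; exact: iG|move=> k].
  apply: has_integral_eq (Gc k) => // x Dx; rewrite /e -sWsW// -[in LHS]gG//; ring.
- have [_ ->] := iG; rewrite -EFin_lim; last first.
    apply: nondecreasing_is_cvgn; last by eexists => _ [n _ <-]; exact: cB.
    by apply/nondecreasing_seqP => n; rewrite big_ord_recr/= lerDl sqr_ge0.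
  by congr (limn _); apply/funext => n /=; rewrite sumEFin big_mkord.
Qed.

End chebyshev_coefficients.

(** * Unitary equivalence *)

Section core.
Context {R : realType} (M : nat).
Local Notation N := M.+1.
Local Notation V := (seq 'I_N).
Local Notation RE := (@complex.Re R).
Local Notation IM := (@complex.Im R).
Notation mu := (@lebesgue_measure R).
Let D : set R := `]-1, 1[.
Implicit Types (f : V -> R[i]) (n : tree_index M).

Definition weight_param n : R := if n is Some _ then 0 else isqrtN M.

Let tp01 n : 0 <= weight_param n <= 1.
Proof. by case: n => [?|] /=; rewrite ?lexx ?ler01// ltW ?isqrtN_gt0 ?isqrtN_le1. Qed.

Let wt n := bs_weight (weight_param n).
Let mm (x : R) := N%:R + 1 - 2 * Num.sqrt N%:R * x.
Let hc n := has_coef (weight_param n).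

(** At index [0] the recurrence produces the coefficient [weight_param n / isqrtN M], which is [1]
    for the radial component and [0] for the others: the [b] of [jacobi]. *)
Let hc_jacobi n g c : hc n g c ->
  hc n (fun x => mm x * g x) (jacobi M (if n is None then 1 else 0) c).
Proof.
(* The innermost [- g + g] supplies the zero function that closes the combination of [g] and
   [x * g]. *)
move=> gc; have := has_coef_lin (tp01 n) (N%:R + 1) gc
  (has_coef_lin (tp01 n) (- 2 * (isqrtN M)^-1) (has_coef_mulX (tp01 n) gc)
    (has_coef_lin (tp01 n) (-1) gc gc)).
have s0 := lt0r_neq0 (@isqrtN_gt0 R M).
congr (has_coef _ _ _); apply/funext.
  by move=> x; rewrite /mm sqrtNE; ring.
move=> k; rewrite /jacobi; case: k => [|k]; last by field.
by case: n {gc} => [?|] /=; field.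
Qed.

Let L2norm2E n (g : R -> R[i]) : measurable_fun D (RE \o g) -> measurable_fun D (IM \o g) ->
  L2norm2 (wt n) g = (\int[mu]_(x in D) (RE (g x) ^+ 2 * wt n x)%:E +
                      \int[mu]_(x in D) (IM (g x) ^+ 2 * wt n x)%:E)%E.
Proof.
move=> mr mi; have mw : measurable_fun D (wt n) by exact: measurable_bs_weight (tp01 n).
have w0 x : D x -> 0 <= wt n x by move=> Dx; rewrite ltW// bs_weight_gt0.
have mr2 : measurable_fun D (fun x => (RE (g x) ^+ 2 * wt n x)).
  by apply: measurable_funM => //; exact: measurable_funX.
have mi2 : measurable_fun D (fun x => (IM (g x) ^+ 2 * wt n x)).
  by apply: measurable_funM => //; exact: measurable_funX.
transitivity (\int[mu]_(x in D) (cnorm2 (g x) * wt n x)%:E)%E.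
  apply: integral_itv_bndoo; apply/measurable_EFinP.
  rewrite (_ : (fun x => _) = (fun x => (RE (g x) ^+ 2 * wt n x)) \+
    (fun x => (IM (g x) ^+ 2 * wt n x))); first exact: measurable_funD.
  by apply/funext => x; rewrite /cnorm2 mulrDl.
have p0 (h : R -> R) x : D x -> (0 <= (h x ^+ 2 * wt n x)%:E)%E.
  by move=> Dx; rewrite lee_fin; apply: mulr_ge0; [exact: sqr_ge0|exact: w0].
rewrite -ge0_integralD//.
- by apply: eq_integral => x _; rewrite /cnorm2 mulrDl EFinD.
- exact: measurable_itv.
- exact: (p0 (RE \o g)).
- exact/measurable_EFinP.
- exact: (p0 (IM \o g)).
- exact/measurable_EFinP.
Qed.

(** Through it, the identities required of the unitary map reduce to equality of coefficient
    sequences. *)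
Let L2norm2_eq0 n (g : R -> R[i]) (g1 g2 h1 h2 : R -> R) c1 c2 :
  hc n g1 c1 -> hc n h1 c1 -> hc n g2 c2 -> hc n h2 c2 ->
  (forall x, RE (g x) = g1 x - h1 x) -> (forall x, IM (g x) = g2 x - h2 x) ->
  L2norm2 (wt n) g = 0%E.
Proof.
move=> gc1 hc1 gc2 hc2 r i; rewrite L2norm2E.
- under eq_integral do rewrite r.
  under [X in (_ + X)%E]eq_integral do rewrite i.
  by rewrite (has_coef_eq (tp01 n) gc1 hc1) (has_coef_eq (tp01 n) gc2 hc2) adde0.
- rewrite (_ : _ \o _ = g1 \- h1); last by apply/funext => x /=; rewrite r.
  by apply: measurable_funB; [case: gc1|case: hc1].
- rewrite (_ : _ \o _ = g2 \- h2); last by apply/funext => x /=; rewrite i.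
  by apply: measurable_funB; [case: gc2|case: hc2].
Qed.

Let esum_le1 (T : choiceType) (F : T -> \bar R) x : (forall y, 0 <= F y)%E ->
  (F x <= \esum_(y in [set: T]) F y)%E.
Proof.
move=> F0; apply: esum_ge; exists [set x]; first by split.
by rewrite fsbig_set1.
Qed.

Let sqE_ge0 (x : R) : (0 <= (x ^+ 2)%:E)%E.
Proof. by rewrite lee_fin sqr_ge0. Qed.

Let l2norm2E f : l2norm2 f = (\esum_(n in [set: tree_index M])
  (\esum_(k in [set: nat]) (tree_coef (RE \o f) n k ^+ 2)%:E +
   \esum_(k in [set: nat]) (tree_coef (IM \o f) n k ^+ 2)%:E))%E.
Proof.
rewrite esumD; [|by move=> n _; exact: esum_ge0..].
by rewrite -!tree_parseval -esumD.
Qed.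

Let tree_coef_fin f n : in_l2 f ->
  (\esum_(k in [set: nat]) (tree_coef (RE \o f) n k ^+ 2)%:E < +oo)%E /\
  (\esum_(k in [set: nat]) (tree_coef (IM \o f) n k ^+ 2)%:E < +oo)%E.
Proof.
rewrite /in_l2 l2norm2E => foo.
have H := @esum_le1 _ (fun n => \esum_(k in [set: nat]) (tree_coef (RE \o f) n k ^+ 2)%:E +
   \esum_(k in [set: nat]) (tree_coef (IM \o f) n k ^+ 2)%:E)%E n
   (fun n => adde_ge0 (esum_ge0 (fun _ _ => sqE_ge0 _)) (esum_ge0 (fun _ _ => sqE_ge0 _))).
have {H foo} := le_lt_trans H foo.
by move=> H; split; apply: le_lt_trans H; rewrite ?leeDl ?leeDr// esum_ge0.
Qed.

Let synth_spec (S : tree_index M -> (nat -> R) -> R -> R) := forall n c,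
  (\esum_(k in [set: nat]) (c k ^+ 2)%:E < +oo)%E ->
  hc n (S n c) c /\ (\int[mu]_(x in D) (S n c x ^+ 2 * wt n x)%:E =
    \esum_(k in [set: nat]) (c k ^+ 2)%:E)%E.

(** A single choice over all pairs of an index and a sequence makes the synthesised function depend
    on the coefficients alone. *)
Let synth_exists : exists S, synth_spec S.
Proof.
suff /choice[S HS] : forall p : tree_index M * (nat -> R), exists g : R -> R,
    (\esum_(k in [set: nat]) (p.2 k ^+ 2)%:E < +oo)%E ->
    hc p.1 g p.2 /\ (\int[mu]_(x in D) (g x ^+ 2 * wt p.1 x)%:E =
      \esum_(k in [set: nat]) (p.2 k ^+ 2)%:E)%E.
  by exists (fun n c => S (n, c)) => n c; exact: (HS (n, c)).
move=> [n c] /=.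
have [coo|coo] := pselect (\esum_(k in [set: nat]) (c k ^+ 2)%:E < +oo)%E.
  by have [g gc ge] := has_coef_exists (tp01 n) coo; exists g.
(* Arbitrary value for sequences that are not square-summable. *)
by exists (fun=> 0).
Qed.

Let hc_fin n g c : hc n g c -> (\esum_(k in [set: nat]) (c k ^+ 2)%:E < +oo)%E.
Proof.
move=> gc; have [_ [v gv] _] := gc.
exact: le_lt_trans (has_coef_bessel (tp01 n) gc gv) (ltry _).
Qed.

(** [U] synthesises functions from tree coefficients. As [S] is an arbitrary choice, linearity and
    intertwining are obtained up to null functions. *)
Lemma tree_laplacian_equiv :
  unitarily_equiv_mult (@tree_laplacian R N) (fun n => bs_weight (weight_param n))
    (fun x => N%:R + 1 - 2 * Num.sqrt N%:R * x).
Proof.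
have [S HS] := synth_exists.
have hcS n g c : hc n g c -> hc n (S n c) c.
  by move=> /hc_fin H; have [] := HS n _ H.
pose U f n x : R[i] := (S n (tree_coef (RE \o f) n) x +i* S n (tree_coef (IM \o f) n) x)%C.
have SU f n : in_l2 f ->
    (hc n (S n (tree_coef (RE \o f) n)) (tree_coef (RE \o f) n) /\
     hc n (S n (tree_coef (IM \o f) n)) (tree_coef (IM \o f) n)) /\
    L2norm2 (wt n) (U f n) =
      (\esum_(k in [set: nat]) (tree_coef (RE \o f) n k ^+ 2)%:E +
       \esum_(k in [set: nat]) (tree_coef (IM \o f) n k ^+ 2)%:E)%E.
  move=> /(tree_coef_fin n)[/(HS n)[h1 <-] /(HS n)[h2 <-]]; split => //.
  by rewrite L2norm2E//; [case: h1|case: h2].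
have Unorm f : in_l2 f -> dsum_norm2 wt (U f) = l2norm2 f.
  by move=> f2; rewrite l2norm2E; apply: eq_esum => n _; have [_ ->] := SU f n f2.
exists U; split.
- move=> f f2; split; last by rewrite Unorm.
  move=> n; have [[[m1 _ _] [m2 _ _]] _] := SU f n f2.
  by split; apply: measurable_fun_itv_cc; [exact: m1|exact: m2].
- move=> [a1 a2] f h f2 h2; apply: esum1 => n _.
  have [[fr fi] _] := SU f n f2.
  have [[hr hi] _] := SU h n h2.
  have H1 := has_coef_lin (tp01 n) a1 fr (has_coef_lin (tp01 n) (- a2) fi hr).
  have H2 := has_coef_lin (tp01 n) a2 fr (has_coef_lin (tp01 n) a1 fi hi).
  set u := (fun y => _ * f y + h y).
  have E1 : tree_coef (RE \o u) n = (fun k => a1 * tree_coef (RE \o f) n k +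
      (- a2 * tree_coef (IM \o f) n k + tree_coef (RE \o h) n k)).
    apply/funext => k; rewrite -!tree_coef_lin; congr tree_coef; apply/funext => y.
    by rewrite /u /=; case: (f y) (h y) => [? ?] [? ?] /=; ring.
  have E2 : tree_coef (IM \o u) n = (fun k => a2 * tree_coef (RE \o f) n k +
      (a1 * tree_coef (IM \o f) n k + tree_coef (IM \o h) n k)).
    apply/funext => k; rewrite -!tree_coef_lin; congr tree_coef; apply/funext => y.
    by rewrite /u /=; case: (f y) (h y) => [? ?] [? ?] /=; ring.
  rewrite -E1 in H1; rewrite -E2 in H2.
  apply: (L2norm2_eq0 (hcS _ _ _ H1) H1 (hcS _ _ _ H2) H2) => x /=; ring.
- exact: Unorm.
- move=> g [mg goo].
  have mgD n : measurable_fun D (RE \o g n) /\ measurable_fun D (IM \o g n).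
    have [m1 m2] := mg n; split; apply: (measurable_funS (measurable_itv `[-1, 1])) => //;
      exact: subset_itv_oo_cc.
  have gE n := L2norm2E n (mgD n).1 (mgD n).2.
  have L0 n : (0 <= L2norm2 (wt n) (g n))%E.
    rewrite gE adde_ge0//; apply: integral_ge0 => x Dx; rewrite lee_fin;
      by apply: mulr_ge0; [exact: sqr_ge0|rewrite ltW// bs_weight_gt0].
  have int0 n (h : R -> R) : (0 <= \int[mu]_(x in D) (h x ^+ 2 * wt n x)%:E)%E.
    apply: integral_ge0 => x Dx; rewrite lee_fin.
    by apply: mulr_ge0; [exact: sqr_ge0|rewrite ltW// bs_weight_gt0].
  have gfin n : (L2norm2 (wt n) (g n) < +oo)%E.
    by apply: le_lt_trans goo; exact: (esum_le1 n L0).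
  have /choice[c1 Hc1] : forall n, exists c, hc n (RE \o g n) c.
    move=> n; apply: (has_coef_intro (tp01 n)); first exact: (mgD n).1.
    by apply: le_lt_trans (gfin n); rewrite gE leeDl.
  have /choice[c2 Hc2] : forall n, exists c, hc n (IM \o g n) c.
    move=> n; apply: (has_coef_intro (tp01 n)); first exact: (mgD n).2.
    by apply: le_lt_trans (gfin n); rewrite gE leeDr.
  (* The preimage of [g] is the tree function with the same coefficients as [g]; Bessel's inequality
     puts it in [l^2]. *)
  pose f w : R[i] := (tree_rebuild c1 w +i* tree_rebuild c2 w)%C.
  have fr n : tree_coef (RE \o f) n = c1 n.
    by apply/funext => k; rewrite -[RHS](tree_coef_rebuild c1); congr tree_coef.
  have fi n : tree_coef (IM \o f) n = c2 n.
    by apply/funext => k; rewrite -[RHS](tree_coef_rebuild c2); congr tree_coef.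
  have bes n (h : R -> R) c : hc n h c ->
      (\esum_(k in [set: nat]) (c k ^+ 2)%:E <= \int[mu]_(x in D) (h x ^+ 2 * wt n x)%:E)%E.
    by move=> Hh; have [_ [v [vi ve]] _] := Hh; rewrite ve; apply: has_coef_bessel Hh _.
  exists f.
    rewrite /in_l2 l2norm2E; apply: le_lt_trans goo.
    by apply: le_esum => n _; rewrite fr fi gE; apply: leeD; exact: bes.
  apply: esum1 => n _.
  by apply: (L2norm2_eq0 (hcS _ _ _ (Hc1 n)) (Hc1 n) (hcS _ _ _ (Hc2 n)) (Hc2 n)) => x;
    rewrite /U fr fi /=; case: (g n x).
- move=> f f2; apply: esum1 => n _.
  have [[hr hi] _] := SU f n f2.
  have J1 := hc_jacobi hr; have J2 := hc_jacobi hi.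
  (* The Laplacian has real coefficients, hence acts on real and imaginary parts separately. *)
  have E1 : tree_coef (RE \o tree_laplacian f) n =
      jacobi M (if n is None then 1 else 0) (tree_coef (RE \o f) n).
    apply/funext => k; rewrite -tree_coef_rlaplacian; congr tree_coef; apply/funext => w.
    rewrite /tree_laplacian /rlaplacian /= raddfD raddf_sum/=; congr (_ + _).
      by apply: eq_bigr => i _; rewrite raddfB.
    by case: w => //= *; rewrite raddfB.
  have E2 : tree_coef (IM \o tree_laplacian f) n =
      jacobi M (if n is None then 1 else 0) (tree_coef (IM \o f) n).
    apply/funext => k; rewrite -tree_coef_rlaplacian; congr tree_coef; apply/funext => w.
    rewrite /tree_laplacian /rlaplacian /= raddfD raddf_sum/=; congr (_ + _).
      by apply: eq_bigr => i _; rewrite raddfB.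
    by case: w => //= *; rewrite raddfB.
  rewrite -E1 in J1; rewrite -E2 in J2.
  by apply: (L2norm2_eq0 (hcS _ _ _ J1) J1 (hcS _ _ _ J2) J2) => x; rewrite /= /mm; ring.
Qed.

End core.

(** * Reindexing of the summands and the two cases of the theorem *)

Lemma unitarily_equiv_mult_reindex (R : realType) (X I J : choiceType)
    (A : (X -> R[i]) -> (X -> R[i])) (w : I -> R -> R) (w' : J -> R -> R) (m : R -> R)
    (e : J -> I) : bijective e -> (forall j, w' j = w (e j)) ->
  unitarily_equiv_mult A w m -> unitarily_equiv_mult A w' m.
Proof.
move=> [e' eK e'K] w'E [U [U1 U2 U3 U4 U5]].
have we : w' = fun j => w (e j) by apply/funext.
have dE (G : I -> R -> R[i]) : dsum_norm2 w' (fun j => G (e j)) = dsum_norm2 w G.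
  rewrite we /dsum_norm2 [RHS](reindex_esum setT _ e)//.
  by split => //; [move=> x y _ _; exact: (can_inj eK)|move=> i _; exists (e' i)].
exists (fun f j => U f (e j)); split.
- by move=> f /U1[mU nU]; split => //; rewrite dE.
- move=> a f h f2 h2; rewrite -[RHS](U2 a f h f2 h2).
  exact: (dE (fun n x => U (fun y => a * f y + h y) n x - (a * U f n x + U h n x))).
- by move=> f f2; rewrite dE U3.
- move=> g [mg ng].
  have gE : g = (fun j => g (e' (e j))) by apply/funext => j; rewrite eK.
  have [|f f2 fg] := U4 (fun i => g (e' i)).
    by split => //; rewrite -dE -gE.
  exists f => //; rewrite gE -[RHS]fg.
  exact: (dE (fun n x => U f n x - g (e' n) x)).
- move=> f f2; rewrite -[RHS](U5 f f2).
  exact: (dE (fun n x => U (A f) n x - (m x)%:C%C * U f n x)).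
Qed.

Lemma w_cpE (R : realType) M : w_cp M.+1 = bs_weight (isqrtN M) :> (R -> R).
Proof. by apply/funext => x; rewrite /w_cp /bs_weight isqrtN_sqr. Qed.

Lemma w_cE (R : realType) : @w_c R = bs_weight 0.
Proof. by apply/funext => x; rewrite /bs_weight mulr0 mul0r subr0 expr0n/= addr0 divr1. Qed.

Lemma nat_bij_words (M k : nat) : exists h : nat -> seq 'I_M.+1 * 'I_k.+1, bijective h.
Proof.
pose T := (seq 'I_M.+1 * 'I_k.+1)%type; pose h n : T := (nseq n ord0, ord0).
have hinj : injective h by move=> m n [/(congr1 size)]; rewrite !size_nseq.
have Tinf : infinite_set [set: T].
  move=> Tfin; apply: infinite_nat; rewrite -(preimage_setT h).
  by apply: finite_preimage Tfin => m n _ _; exact: hinj.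
have /pcard_eqP[f] := eq_card_nat (countableP [set: T]) Tinf.
by have [g fK gK] := @bijTT _ _ f; exists g, f.
Qed.

Theorem theorem3p26 (R : realType) (N : nat) (hN : (1 <= N)%N) :
  (N = 1%N ->
     unitarily_equiv_mult (@tree_laplacian R N)
       (fun _ : unit => w_cp N) (fun x : R => 2 - 2 * x)) /\
  ((2 <= N)%N ->
     unitarily_equiv_mult (@tree_laplacian R N)
       (fun n : option nat => if n is Some _ then @w_c R else w_cp N)
       (fun x : R => N%:R + 1 - 2 * Num.sqrt N%:R * x)).
Proof.
split=> [->|].
- have := @tree_laplacian_equiv R 0; rewrite sqrtr1.
  rewrite (_ : (fun x : R => 1 + 1 - 2 * 1 * x) = (fun x => 2 - 2 * x)); last first.
    by apply/funext => x; rewrite mulr1.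
  (* With a single child there is no zero-sum direction: ['I_0] is empty and [None] is the only
     index. *)
  apply: (@unitarily_equiv_mult_reindex _ _ _ _ _ _ _ _ (fun=> None)).
    by exists (fun=> tt) => [[]//|[[w []]|]].
  by move=> _; rewrite w_cpE.
- case: N hN => [//|[//|M]] _ _.
  have [h [h' hK h'K]] := nat_bij_words M.+1 M.
  (* [omap] keeps the radial summand [None] in place and enumerates all the others. *)
  apply: (unitarily_equiv_mult_reindex (e := omap h)) (tree_laplacian_equiv M.+1).
    by exists (omap h'); case=> //= n; rewrite ?hK ?h'K.
  by case=> [n|] /=; rewrite ?w_cE ?w_cpE.
Qed.
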